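(* Let $\mathscr H$ and $\mathfrak h$ be Hilbert spaces, let $A:\mathscr D(A)\subseteq\mathscr H\to\mathscr H$ be a self-adjoint operator with $0\in\rho(A)$, and let $\tau:\mathscr D(A)\to\mathfrak h$ be linear, continuous with respect to the graph norm on $\mathscr D(A)$, surjective, and with kernel $\ker\tau$ dense in $\mathscr H$. Let $\Pi$ be an orthogonal projection in $\mathfrak h$, let $\Theta$ be a self-adjoint operator in the Hilbert space $\mathrm{Ran}(\Pi)$, and let $A^{\Pi,\Theta}$ be the corresponding self-adjoint extension of $A|_{\ker\tau}$ (defined in the context). Let $\lambda\in\sigma_p(A)$, let $\mathscr H_\lambda=\ker(A-\lambda)$, let $P_\lambda$ be the orthogonal projector of $\mathscr H$ onto $\mathscr H_\lambda$, and let $\mathscr H^{\Pi,\Theta}_\lambda=\{\phi\in\mathscr D(A^{\Pi,\Theta}): A^{\Pi,\Theta}\phi=\lambda\phi\}$. 1) Suppose $\mathrm{Ran}(\Pi)\cap(\mathrm{Ran}(\tau P_\lambda))^\perp=\{0\}$, and put $$\mathscr K^\Pi_\lambda:=\{\psi\in\mathscr H_\lambda : \Pi\tau\psi=0\}.$$ Then $$\lambda\in\sigma_p(A^{\Pi,\Theta})\iff\mathscr K^\Pi_\lambda\neq\{0\},$$ and $\mathscr H^{\Pi,\Theta}_\lambda=\mathscr K^\Pi_\lambda$. 2) Suppose $\mathrm{Ran}(\Pi)\cap(\mathrm{Ran}(\tau P_\lambda))^\perp\neq\{0\}$ and that $\lambda$ is isolated (i.e. an isolated point of $\sigma(A)$).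 Let $\mathscr N^{\Pi,\Theta}_\lambda$ be the set of couples $(\psi,\xi)\in\mathscr H_\lambda\oplus\mathrm{Ran}(\Pi)$ such that $$\xi\in\mathscr D(\Theta)\cap(\mathrm{Ran}(\tau P_\lambda))^\perp,\qquad \Pi\tau\psi=(\Theta+\lambda\,\Pi G_0^*G_\lambda^\perp\Pi)\,\xi,$$ where $G_0$ and $G_\lambda^\perp$ are the operators defined in the context. Then $$\lambda\in\sigma_p(A^{\Pi,\Theta})\iff\mathscr N^{\Pi,\Theta}_\lambda\neq\{0\},$$ $$\dim(\mathscr H^{\Pi,\Theta}_\lambda)=\dim(\mathscr N^{\Pi,\Theta}_\lambda),$$ and $$\mathscr H^{\Pi,\Theta}_\lambda=\{\phi\in\mathscr H : \phi=\psi+G_\lambda^\perp\xi,\ (\psi,\xi)\in\mathscr N^{\Pi,\Theta}_\lambda\}.$$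
   Context: Notation: $\mathscr D(L)$, $\mathrm{Ran}(L)$, $\rho(L)$, $\sigma(L)$, $\sigma_p(L)$ denote the domain, range, resolvent set, spectrum and point spectrum (set of eigenvalues) of an operator $L$. Orthogonal complements of subsets of $\mathfrak h$ are taken in $\mathfrak h$. Operators $G_z$: for $z\in\rho(A)$, $$G_z:\mathfrak h\to\mathscr H,\qquad G_z:=\left(\tau(-A+\bar z)^{-1}\right)^*,$$ a bounded operator. In particular, since $0\in\rho(A)$, $G_0=(\tau(-A)^{-1})^*$. It is known that $G_z$ is injective and $\mathrm{Ran}(G_z)\cap\mathscr D(A)=\{0\}$. The extension $A^{\Pi,\Theta}$: given an orthogonal projection $\Pi$ in $\mathfrak h$ and a (possibly unbounded) self-adjoint operator $\Theta:\mathscr D(\Theta)\subseteq\mathrm{Ran}(\Pi)\to\mathrm{Ran}(\Pi)$ in the Hilbert space $\mathrm{Ran}(\Pi)$, define $$\mathscr D(A^{\Pi,\Theta}):=\{\phi=\phi_0+G_0\xi_\phi : \phi_0\in\mathscr D(A),\ \xi_\phi\in\mathscr D(\Theta),\ \Pi\tau\phi_0=\Theta\xi_\phi\},\qquad A^{\Pi,\Theta}\phi:=A\phi_0.$$ The decomposition $\phi=\phi_0+G_0\xi_\phi$ is unique because $\mathrm{Ran}(G_0)\cap\mathscr D(A)=\{0\}$ and $G_0$ is injective. It is known that $A^{\Pi,\Theta}$ is a self-adjoint extension of the symmetric operator $S=A|_{\ker\tau}$, and that all self-adjoint extensions of $S$ are of this form. The operator $G_\lambda^\perp$: for $\lambda\in\sigma_p(A)$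 isolated in $\sigma(A)$, put $P_\lambda^\perp:=1-P_\lambda$. Then $\lambda$ belongs to the resolvent set of the restriction of $A$ to $\mathscr H_\lambda^\perp$, so that $(-A+\lambda)^{-1}P_\lambda^\perp:\mathscr H\to\mathscr D(A)$ is well defined, meaning $P_\lambda^\perp$ followed by the inverse of $-A+\lambda$ on $\mathscr H_\lambda^\perp$. Define the bounded operator $$G_\lambda^\perp:\mathfrak h\to\mathscr H,\qquad G_\lambda^\perp:=\left(\tau(-A+\lambda)^{-1}P_\lambda^\perp\right)^*.$$ *)

(* Defs.v *)
From HB Require Import structures.
From mathcomp Require Import all_boot all_order all_algebra sesquilinear complex.
From mathcomp Require Import all_classical all_reals topology normedtype.

Set Implicit Arguments.
Unset Strict Implicit.
Unset Printing Implicit Defensive.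

Import Order.TTheory GRing.Theory Num.Theory.
Import numFieldNormedType.Exports.

Local Open Scope classical_set_scope.
Local Open Scope ring_scope.
Local Open Scope card_scope.

(* Complex Hilbert spaces: a complete normed module over R[i] whose norm comes
   from an inner product (linear in the first argument, antilinear in the
   second). *)
HB.mixin Record isHilbert (R : realType) H of CompleteNormedModule R[i] H := {
  inner : {dot H for (@Num.conj R[i])};
  inner_norm : forall x : H, inner x x = `|x| ^+ 2
}.

#[short(type="hilbertType")]
HB.structure Definition Hilbert (R : realType) :=
  {H of CompleteNormedModule R[i] H & isHilbert R H}.

(* A possibly unbounded operator is a function together with a domain; values
   outside [dom] are irrelevant. Linearity is the separate predicate
   [linear_op], so that inverses and adjoints are always definable. *)
Record operator (U V : Type) := Operator { dom : set U ; app :> U -> V }.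

(* The operator with a given graph. When y is not determined by x, the value
   is an arbitrary choice; below, the graphs are functional in every use. *)
Definition op_of_graph (U : Type) (V : nmodType) (g : U -> V -> Prop) :
    operator U V :=
  Operator [set x | exists y, g x y] (fun x => xget 0 [set y | g x y]).

Definition total_op (U V : Type) (f : U -> V) : operator U V :=
  Operator [set: U] f.

Definition op_comp (U V W : Type) (M : operator V W) (L : operator U V) :
    operator U W :=
  Operator [set x | dom L x /\ dom M (L x)] (fun x => M (L x)).

Definition op_restr (U V : Type) (L : operator U V) (S : set U) :
    operator U V :=
  Operator (dom L `&` S) L.

Definition op_inv (U V : nmodType) (L : operator U V) : operator V U :=
  op_of_graph (fun y x => dom L x /\ L x = y).

Definition ran (U V : Type) (L : operator U V) : set V := L @` dom L.

Definition op_ker (U V : nmodType) (L : operator U V) : set U :=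
  [set x | dom L x /\ L x = 0].

Definition linear_op (K : numFieldType) (U V : lmodType K)
    (L : operator U V) : Prop :=
  [/\ dom L 0,
      forall a x y, dom L x -> dom L y -> dom L (a *: x + y) &
      forall a x y, dom L x -> dom L y -> L (a *: x + y) = a *: L x + L y].

(* - L + z *)
Definition op_neg_add (K : numFieldType) (U : lmodType K) (L : operator U U)
    (z : K) : operator U U :=
  Operator (dom L) (fun x => - L x + z *: x).

Definition eigenspace_op (K : numFieldType) (U : lmodType K)
    (L : operator U U) (z : K) : set U :=
  [set x | dom L x /\ L x = z *: x].

Definition point_spectrum (K : numFieldType) (U : lmodType K)
    (L : operator U U) : set K :=
  [set z | exists2 x, eigenspace_op L z x & x != 0].

Section HilbertOperators.
Context {R : realType}.
Local Notation C := R[i].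
Implicit Types H G : hilbertType R.

Definition orthoc H (S : set H) : set H :=
  [set y | forall x, S x -> inner x y = 0].

Definition orthogonal_projection H (P : {linear H -> H}) : Prop :=
  (forall x, P (P x) = P x) /\ (forall x y, inner (P x) y = inner x (P y)).

(* (y, z) belongs to the graph of the adjoint of L *)
Definition adjoint_graph H G (L : operator H G) (y : G) (z : H) : Prop :=
  forall x, dom L x -> inner (L x) y = inner x z.

(* Meaningful when [dom L] is dense. *)
Definition op_adj H G (L : operator H G) : operator G H :=
  op_of_graph (adjoint_graph L).

(* L is a self-adjoint operator in the Hilbert space K, a closed subspace of H
   with the induced inner product: L is densely defined in K, and L coincides
   (domain included) with its adjoint taken in K. *)
Definition selfadjoint_in H (K : set H) (L : operator H H) : Prop :=
  [/\ linear_op L,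
      dom L `<=` K,
      ran L `<=` K,
      K `<=` closure (dom L) &
      forall y z, K y -> K z ->
        adjoint_graph L y z <-> dom L y /\ L y = z].

Definition selfadjoint H (L : operator H H) : Prop := selfadjoint_in setT L.

Definition resolvent_set H (L : operator H H) : set C :=
  [set z | [/\ forall x, dom L x -> op_neg_add L z x = 0 -> x = 0,
               ran (op_neg_add L z) = setT &
               continuous (op_inv (op_neg_add L z))]].

Definition spectrum H (L : operator H H) : set (C : numFieldType) :=
  ~` resolvent_set L.

Definition graph_norm H (L : operator H H) (x : H) : C :=
  sqrtC (`|x| ^+ 2 + `|L x| ^+ 2).

Definition graph_continuous H G (A : operator H H) (tau : operator H G) :
    Prop :=
  forall x, dom A x -> forall e : C, 0 < e -> exists2 d : C, 0 < d &
    forall y, dom A y -> graph_norm A (y - x) < d -> `|tau y - tau x| < e.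

(* G_z = (tau (- A + z^* )^-1)^* *)
Definition Gop H G (A : operator H H) (tau : operator H G) (z : C) :
    operator G H :=
  op_adj (op_comp tau (op_inv (op_neg_add A (Num.conj z)))).

(* (tau (- A + lam)^-1 (1 - P))^*, the inverse being that of - A + lam on the
   orthogonal complement of the eigenspace of lam *)
Definition Gperp H G (A : operator H H) (tau : operator H G) (lam : C)
    (P : H -> H) : operator G H :=
  op_adj
    (op_comp tau
      (op_comp
        (op_inv (op_restr (op_neg_add A lam) (orthoc (eigenspace_op A lam))))
        (total_op (fun x => x - P x)))).

Definition extension H G (A : operator H H) (tau : operator H G)
    (Pi : G -> G) (Theta : operator G G) : operator H H :=
  op_of_graph (fun phi w => exists phi0 xi,
    [/\ dom A phi0, dom Theta xi, Pi (tau phi0) = Theta xi,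
        phi = phi0 + Gop A tau 0 xi & w = A phi0]).

Definition Kset H G (A : operator H H) (tau : operator H G) (Pi : G -> G)
    (lam : C) : set H :=
  [set psi | eigenspace_op A lam psi /\ Pi (tau psi) = 0].

Definition Nset H G (A : operator H H) (tau : operator H G) (Pi : G -> G)
    (Theta : operator G G) (lam : C) (P : H -> H) : set (H * G) :=
  [set p | [/\ eigenspace_op A lam p.1,
               range Pi p.2,
               (dom Theta `&` orthoc (ran (op_comp tau (total_op P)))) p.2 &
               Pi (tau p.1) = Theta p.2 +
                 lam *: Pi (op_adj (Gop A tau 0)
                             (Gperp A tau lam P (Pi p.2)))]].

End HilbertOperators.

Definition is_basis (K : numFieldType) (U : lmodType K) (V B : set U) : Prop :=
  [/\ B `<=` V,
      forall (s : seq U) (c : U -> K), uniq s -> [set` s] `<=` B ->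
        \sum_(u <- s) c u *: u = 0 -> forall u, u \in s -> c u = 0 &
      forall v, V v -> exists (s : seq U) (c : U -> K),
        [set` s] `<=` B /\ v = \sum_(u <- s) c u *: u].

(* dim V = dim W for linear subspaces V and W, as (possibly infinite) cardinals:
   the cardinality of a basis does not depend on the basis. *)
Definition same_dim (K : numFieldType) (U1 U2 : lmodType K)
    (V : set U1) (W : set U2) : Prop :=
  exists (B1 : set U1) (B2 : set U2),
    [/\ is_basis V B1, is_basis W B2 & B1 #= B2].

(* Main.v *)
(* The eigenvalue equation for the extension reads [A phi0 = lam phi] with
   [phi = phi0 + G_0 xi]. Pairing it with eigenvectors of [A] gives
   [xi \in (Ran (tau P))^\perp], which is the first part. For such [xi],
   [eta := G_lam^\perp xi - G_0 xi] lies in [dom A] with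
   [A eta = lam G_lam^\perp xi], so that [phi = psi + G_lam^\perp xi], where
   [psi := phi0 - eta] is an eigenvector of [A]; the boundary condition for
   [phi0] becomes the one defining [N], because
   [lam G_0^* G_lam^\perp xi = - tau eta].

   The analytic point is that [S := - A + lam] is boundedly invertible on the
   complement of its kernel when [lam] is isolated, without the spectral
   theorem. A symmetric operator whose spectrum avoids [(c - r, c + r)]
   satisfies [|(A - c) x| >= r |x|]; applied to the two intervals
   [(lam, lam + d)] and [(lam - d, lam)] this says [d |<S x, x>| <= |S x|^2].
   Polarization yields [d |<S u, x>| <= |S u| |S x|], and then
   [d |x| <= |S x|] for [x] orthogonal to [ker S]. *)

Require Import Defs.
From HB Require Import structures.
From mathcomp Require Import all_boot all_order all_algebra sesquilinear complex.
From mathcomp Require Import all_classical all_reals topology normedtype.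
From mathcomp Require Import ring lra.

Set Implicit Arguments.
Unset Strict Implicit.
Unset Printing Implicit Defensive.

Import Order.TTheory GRing.Theory Num.Theory.
Import numFieldNormedType.Exports.

Local Open Scope classical_set_scope.
Local Open Scope ring_scope.

(** * Real inner product and Riesz representation *)

Section RealInnerProduct.
Context {R : realType} {H : hilbertType R}.
Implicit Types (x y z : H) (a : R).

Local Notation Cx a := (real_complex R a).

(** The norm of [H] takes values in [R[i]], whose order is only partial. Real parts give access to
    suprema and to real arithmetic. *)
Definition rnorm (x : H) : R := complex.Re `|x|.
Definition rdot (x y : H) : R := complex.Re (inner x y).

(** Scalars are real because minimization and the gap argument are carried out in the underlying
    real Hilbert space; complex identities are recovered by [inner_of_rdot]. *)
Definition real_subspace (V : set H) : Prop :=
  V 0 /\ forall (a : R) x y, V x -> V y -> V (Cx a *: x + y).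

Lemma rnormE x : `|x| = Cx (rnorm x).
Proof. by rewrite RRe_real// ger0_real. Qed.

Lemma rnorm_ge0 x : 0 <= rnorm x.
Proof. by rewrite -ler0c -rnormE. Qed.

Lemma rnorm_eq0 x : rnorm x = 0 -> x = 0.
Proof. by move=> h; apply/eqP; rewrite -normr_eq0 rnormE h. Qed.

Lemma rnormN x : rnorm (- x) = rnorm x.
Proof. by rewrite /rnorm normrN. Qed.

Lemma rnormD x y : rnorm (x + y) <= rnorm x + rnorm y.
Proof. by rewrite -lecR rmorphD/= -!rnormE ler_normD. Qed.

Lemma innerC x y : inner x y = (inner y x)^*%C.
Proof. by rewrite (hermC (@inner R H)) expr0 mul1r. Qed.

Lemma rdotC x y : rdot x y = rdot y x.
Proof. by rewrite /rdot innerC; case: (inner y x). Qed.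

Lemma innerDl x y z : inner (x + y) z = inner x z + inner y z.
Proof. exact: linearDl. Qed.

Lemma innerZl (c : R[i]) x z : inner (c *: x) z = c * inner x z.
Proof. exact: linearZl_LR. Qed.

Lemma innerDr x y z : inner z (x + y) = inner z x + inner z y.
Proof. exact: linearDr. Qed.

Lemma innerZr (c : R[i]) x z : inner z (c *: x) = c^*%C * inner z x.
Proof. exact: linearZr_LR. Qed.

Lemma innerNl x y : inner (- x) y = - inner x y.
Proof. exact: linearNl. Qed.

Lemma innerNr x y : inner x (- y) = - inner x y.
Proof. exact: linearNr. Qed.

Lemma inner0l x : inner 0 x = 0.
Proof. exact: linear0l. Qed.

Lemma inner0r x : inner x 0 = 0.
Proof. exact: linear0r. Qed.

Lemma inner_eq0 x : inner x x = 0 -> x = 0.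
Proof. by rewrite inner_norm => /eqP; rewrite sqrf_eq0 normr_eq0 => /eqP. Qed.

Lemma inner_ext y z : (forall x, inner x y = inner x z) -> y = z.
Proof.
move=> e; apply/eqP; rewrite -subr_eq0; apply/eqP/inner_eq0.
by rewrite innerDr innerNr e subrr.
Qed.

Lemma rdotDl x y z : rdot (x + y) z = rdot x z + rdot y z.
Proof. by rewrite /rdot innerDl raddfD. Qed.

Lemma rdotZl a x z : rdot (Cx a *: x) z = a * rdot x z.
Proof. by rewrite /rdot innerZl; case: (inner x z) => u v /=; ring. Qed.

Lemma rdotNl x z : rdot (- x) z = - rdot x z.
Proof. by rewrite /rdot innerNl raddfN. Qed.

Lemma rdotDr x y z : rdot z (x + y) = rdot z x + rdot z y.
Proof. by rewrite rdotC rdotDl !(rdotC z). Qed.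

Lemma rdotZr a x z : rdot z (Cx a *: x) = a * rdot z x.
Proof. by rewrite rdotC rdotZl !(rdotC z). Qed.

Lemma rdotNr x z : rdot z (- x) = - rdot z x.
Proof. by rewrite rdotC rdotNl !(rdotC z). Qed.

Definition rdotE := (rdotDl, rdotDr, rdotNl, rdotNr, rdotZl, rdotZr).

Lemma rdotxx x : rdot x x = rnorm x ^+ 2.
Proof. by rewrite /rdot inner_norm rnormE -rmorphXn. Qed.

(** Linearity in the first slot gives [Re <i x, y> = - Im <x, y>], so real identities at [x] and at
    [i x] determine the complex one. *)
Lemma innerE x y : inner x y = Cx (rdot x y) - 'i%C * Cx (rdot ('i%C *: x) y).
Proof.
rewrite /rdot innerZl; case: (inner x y) => u v.
by apply/eqP; rewrite eq_complex /=; apply/andP; split; apply/eqP; ring.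
Qed.

Lemma rnormZ a x : 0 <= a -> rnorm (Cx a *: x) = a * rnorm x.
Proof.
move=> a0; apply: complexI; rewrite rmorphM/= -!rnormE normrZ.
by rewrite ger0_norm// ler0c.
Qed.

(** Source of [rdot_le], of the minimality estimate in [riesz_real] and of polarization. Evaluate at
    the vertex [- b / c]; for [c = 0] the polynomial is affine and reaches -1 unless [b = 0]. *)
Lemma quadratic_ge0_discr (a b c : R) : 0 <= c ->
  (forall t, 0 <= a + 2 * t * b + t ^+ 2 * c) -> b ^+ 2 <= a * c.
Proof.
move=> c0 ht; have [c00|cn] := eqVneq c 0.
  have [->|bn] := eqVneq b 0; first by rewrite c00 expr0n mulr0.
  have := ht (- (a + 1) / (2 * b)); rewrite c00 mulr0 addr0.
  have -> : a + 2 * (- (a + 1) / (2 * b)) * b = -1 by field.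
  lra.
have cp : 0 < c by rewrite lt_neqAle eq_sym cn.
have := ht (- b / c).
have -> : a + 2 * (- b / c) * b + (- b / c) ^+ 2 * c = (a * c - b ^+ 2) / c by field.
by rewrite pmulr_lge0 ?invr_gt0// subr_ge0.
Qed.

Lemma rdot_le x y : `|rdot x y| <= rnorm x * rnorm y.
Proof.
rewrite -[leRHS]ger0_norm ?mulr_ge0 ?rnorm_ge0// -ler_sqr ?nnegrE//.
rewrite !real_normK ?num_real// exprMn.
apply: quadratic_ge0_discr => [|t]; first exact: sqr_ge0.
have := sqr_ge0 (rnorm (x + Cx t *: y)).
by rewrite -!rdotxx !rdotE (rdotC y x); congr (_ <= _); ring.
Qed.

Lemma cvg_rnormP (F : set_system H) (FF : Filter F) z :
  F --> z <-> forall e, 0 < e -> \forall x \near F, rnorm (z - x) < e.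
Proof.
split=> [Fz e e0|Fz].
  have e0C : 0 < Cx e by rewrite ltcR.
  have := Fz _ (nbhsx_ballx z (Cx e) e0C).
  by apply: filterS => x; rewrite -ball_normE /= rnormE ltcR.
apply/cvg_ballP => e e0.
have eE : e = Cx (complex.Re e) by rewrite RRe_real// gtr0_real.
have := Fz (complex.Re e); rewrite -ltcR -eE => /(_ e0).
by apply: filterS => x; rewrite -ball_normE /= rnormE eE ltcR.
Qed.

Lemma hilbert_complete (F : set_system H) (FF : ProperFilter F) :
  (forall e : R, 0 < e -> exists2 B, F B &
     forall x y, B x -> B y -> rnorm (x - y) < e) ->
  exists z, F --> z.
Proof.
move=> hF; exists (lim F); apply: cauchy_cvg; apply/cauchy_ballP => e e0.
have eE : e = Cx (complex.Re e) by rewrite RRe_real// gtr0_real.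
have [|B FB hB] := hF (complex.Re e); first by rewrite -ltcR -eE.
exists (B, B) => // -[x y] /= [Bx By].
by rewrite -ball_normE /= rnormE eE ltcR; apply: hB.
Qed.

Lemma ler_addgt0Ml (a b k : R) :
  0 <= k -> (forall e, 0 < e -> a <= b + e * k) -> a <= b.
Proof.
move=> k0 h; apply/ler_addgt0Pr => e e0.
have k1 : 0 < k + 1 by lra.
apply: (le_trans (h (e / (k + 1)) _)); first by rewrite divr_gt0.
rewrite lerD2l -mulrA -[leRHS]mulr1 ler_pM2l// ler_pdivrMl// mulr1; lra.
Qed.

(* [z] is the limit of a minimizing sequence in [V] of the functional
   [J x = |x|^2 - 2 f x]; completeness of [V] itself is not needed. *)
Lemma riesz_real (V : set H) (f : H -> R) (c : R) :
    real_subspace V ->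
    (forall a x y, V x -> V y -> f (Cx a *: x + y) = a * f x + f y) ->
    0 <= c -> (forall x, V x -> `|f x| <= c * rnorm x) ->
  exists2 z, rnorm z <= c & forall v, V v -> f v = rdot v z.
Proof.
move=> [V0 VD] fD c0 fc.
pose J x := rnorm x ^+ 2 - 2 * f x.
have Jge x : V x -> - c ^+ 2 <= J x.
  move=> /fc; rewrite ler_norml => /andP[_ h].
  by have := sqr_ge0 (rnorm x - c); rewrite /J; nra.
pose m := inf (J @` V).
have hE : has_inf (J @` V).
  split; first by exists (J 0); exists 0.
  by exists (- c ^+ 2) => _ [x Vx <-]; apply: Jge.
have mJ x : V x -> m <= J x by move=> Vx; apply: ge_inf; [case: hE|exists x].
have VDa x y : V x -> V y -> V (x + y).
  by move=> Vx Vy; have := VD 1 x y Vx Vy; rewrite scale1r.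
have Vsc a x : V x -> V (Cx a *: x).
  by move=> Vx; have := VD a x 0 Vx V0; rewrite addr0.
have f0 : f 0 = 0.
  by have := fD (-1) 0 0 V0 V0; rewrite scaler0 addr0; lra.
have fDa x y : V x -> V y -> f (x + y) = f x + f y.
  by move=> Vx Vy; have := fD 1 x y Vx Vy; rewrite scale1r mul1r.
have fsc a x : V x -> f (Cx a *: x) = a * f x.
  by move=> Vx; have := fD a x 0 Vx V0; rewrite f0 !addr0.
(* Parallelogram law, combined with [m <= J] at the midpoint of [x] and [y]. *)
have JB x y : V x -> V y -> rnorm (x - y) ^+ 2 <= 2 * (J x + J y - 2 * m).
  move=> Vx Vy; have := mJ _ (Vsc 2^-1 _ (VDa _ _ Vx Vy)).
  rewrite /J fsc ?fDa//; last exact: VDa.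
  rewrite -!rdotxx !rdotE (rdotC y x); lra.
pose B (e : R) := [set x | V x /\ J x < m + e].
(* The filter generated by the near-minimal sets [B e] plays the part of a minimizing sequence; [JB]
   makes it Cauchy. *)
pose F := filter_from [set e : R | 0 < e] B.
have FF : ProperFilter F.
  apply: filter_from_proper => [|e e0].
    apply: filter_from_filter; first by exists 1 => /=.
    move=> e d /= e0 d0; exists (Num.min e d); first by rewrite lt_min e0.
    move=> x [Vx]; rewrite /B /=.
    by rewrite -ltrBlDl lt_min !ltrBlDl => /andP[].
  by have [_ [x Vx <-] h] := inf_adherent e0 hE; exists x.
have [e e0|z Fz] := hilbert_complete FF.
  exists (B (e ^+ 2 / 4)); first by exists (e ^+ 2 / 4) => //=;
    rewrite divr_gt0 ?exprn_gt0.
  move=> x y [Vx hx] [Vy hy].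
  rewrite -ltr_sqr ?nnegrE ?rnorm_ge0 ?(ltW e0)//.
  by apply: le_lt_trans (JB x y Vx Vy) _; lra.
have near e : 0 < e -> exists x, [/\ V x, J x < m + e ^+ 2 & rnorm (z - x) < e].
  move=> e0; have [x /= [[Vx Jx] xz]] : exists x,
      (B (e ^+ 2) `&` [set x | rnorm (z - x) < e]) x.
    apply: (@filter_ex _ F); apply: filterI; last exact: (proj1 (cvg_rnormP _ _) Fz).
    by exists (e ^+ 2) => //=; rewrite exprn_gt0.
  by exists x.
have fz v : V v -> f v = rdot v z.
  move=> Vv; apply/eqP; rewrite -subr_eq0 -normr_le0.
  have k0 : 0 <= 2 * rnorm v by rewrite mulr_ge0 ?rnorm_ge0.
  apply: (ler_addgt0Ml k0) => e e0; rewrite add0r.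
  have [x [Vx Jx xz]] := near e e0.
  have -> : f v - rdot v z = (f v - rdot v x) + rdot v (x - z).
    by rewrite !rdotE; ring.
  rewrite (le_trans (ler_normD _ _))// mulrCA mulr_natl mulr2n; apply: lerD; last first.
    apply: le_trans (rdot_le _ _) _; rewrite mulrC ler_wpM2r ?rnorm_ge0//.
    by rewrite -rnormN opprB ltW.
  (* Up to [e^2], [x] minimizes [J] along the line [x + t v]; the discriminant of this quadratic in
     [t] bounds the defect of the Euler equation. *)
  have h : (rdot v x - f v) ^+ 2 <= e ^+ 2 * rnorm v ^+ 2.
    apply: quadratic_ge0_discr => [|t]; first exact: sqr_ge0.
    have := mJ _ (VD t _ _ Vv Vx).
    rewrite /J fD// -!rdotxx !rdotE (rdotC x v).
    by move: Jx; rewrite /J -rdotxx; lra.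
  rewrite -ler_sqr ?nnegrE ?mulr_ge0 ?rnorm_ge0 ?(ltW e0)//.
  by rewrite real_normK ?num_real// -sqrrN opprB exprMn.
exists z => //.
(* Since [z] may lie outside [V], [f z] cannot be used; instead [<x, z> = f x] for [x] in [V] close
   to [z]. *)
have : rnorm z ^+ 2 <= c * rnorm z.
  have k0 : 0 <= rnorm z + c by rewrite addr_ge0 ?rnorm_ge0.
  apply: (ler_addgt0Ml k0) => e e0.
  have [x [Vx _ xz]] := near e e0.
  have := rdot_le (z - x) z.
  rewrite !rdotE rdotxx -fz// ler_norml => /andP[_ h1].
  have := fc x Vx; rewrite ler_norml => /andP[_ h2].
  have := rnormD (x - z) z; rewrite subrK -(rnormN (x - z)) opprB => h3.
  have := rnorm_ge0 z; nra.
have [z0|z0] := eqVneq (rnorm z) 0; first by rewrite z0.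
by rewrite expr2 ler_pM2r// lt_neqAle eq_sym z0 rnorm_ge0.
Qed.

End RealInnerProduct.

(** * Symmetric operators bounded below *)

Section BoundedBelow.
Context {R : realType} {H : hilbertType R}.
Local Notation Cx a := (real_complex R a).

Definition real_linear_on (G : hilbertType R) (V : set H) (B : H -> G) : Prop :=
  forall (a : R) x y, V x -> V y -> B (Cx a *: x + y) = Cx a *: B x + B y.

(** Turns continuity at 0 into a linear bound. Dividing [x] by [t = 2 q x / d + e] brings [q] below
    [d], hence [p x < t]; the slack [e] keeps [t] positive when [q x = 0]. *)
Lemma homogeneous_bound (V : set H) (p q : H -> R) (d : R) :
    0 < d -> (forall (a : R) x, V x -> V (Cx a *: x)) ->
    (forall (a : R) x, 0 <= a -> V x -> p (Cx a *: x) = a * p x) ->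
    (forall (a : R) x, 0 <= a -> V x -> q (Cx a *: x) = a * q x) ->
    (forall x, V x -> 0 <= q x) -> (forall x, V x -> q x < d -> p x < 1) ->
  forall x, V x -> p x <= 2 / d * q x.
Proof.
move=> d0 Vs ps qs q0 pq x Vx; apply/ler_addgt0Pr => e e0.
set t := _ + e.
have t0 : 0 < t by rewrite ltr_wpDl// mulr_ge0 ?q0// divr_ge0 ?(ltW d0).
have it0 : 0 <= t^-1 by rewrite invr_ge0 ltW.
have := pq (Cx t^-1 *: x) (Vs _ _ Vx); rewrite ps// qs//.
rewrite !ltr_pdivrMl// mulr1 => h; apply/ltW/h.
have -> : t * d = 2 * q x + e * d by rewrite /t; field; rewrite gt_eqF.
have := q0 _ Vx; have := mulr_gt0 e0 d0; lra.
Qed.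

Context (V : set H) (B : H -> H).
Hypothesis V_subspace : real_subspace V.
Hypothesis B_linear : real_linear_on V B.
Hypothesis B_symmetric : forall x y, V x -> V y -> rdot (B x) y = rdot x (B y).

Let VZ (a : R) x : V x -> V (Cx a *: x).
Proof.
by move=> Vx; rewrite -[_ *: _]addr0; apply: V_subspace.2 => //;
  exact: V_subspace.1.
Qed.

Let VD x y : V x -> V y -> V (x + y).
Proof. by move=> Vx Vy; rewrite -(scale1r x); apply: (V_subspace.2 1). Qed.

Let B0 : B 0 = 0.
Proof.
have := B_linear (-1) V_subspace.1 V_subspace.1.
by rewrite rmorphN1 !scaleN1r oppr0 add0r addNr.
Qed.

Let BZ (a : R) x : V x -> B (Cx a *: x) = Cx a *: B x.
Proof.
by move=> Vx; rewrite -[X in B X]addr0 B_linear ?B0 ?addr0//; exact: V_subspace.1.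
Qed.

Let BD x y : V x -> V y -> B (x + y) = B x + B y.
Proof. by move=> Vx Vy; rewrite -{1}(scale1r x) (B_linear 1)// scale1r. Qed.

(* The norm [t] of [B^-1] is an approximate singular value of [B^-1]: were
   [r t > 1], the number [1 / t] or its opposite would be an approximate
   eigenvalue of [B] in the interval [(- r, r)]. *)
Lemma symmetric_gap (r : R) :
    (forall y, exists2 x, V x & B x = y) ->
    (forall s : R, `|s| < r -> exists2 k : R, 0 < k &
       forall x, V x -> k * rnorm x <= rnorm (B x + Cx s *: x)) ->
  forall x, V x -> r * rnorm x <= rnorm (B x).
Proof.
move=> Bsurj Bs x0 Vx0; rewrite leNgt; apply/negP => hx0.
have r0 : 0 < r.
  rewrite ltNge; apply/negP => r0.
  have := rnorm_ge0 (B x0); have := rnorm_ge0 x0; nra.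
have [k k0 hk] : exists2 k : R, 0 < k & forall x, V x -> k * rnorm x <= rnorm (B x).
  have [|k k0 hk] := Bs 0; first by rewrite normr0.
  by exists k => // x Vx; have := hk x Vx; rewrite rmorph0 scale0r addr0.
(* The supremum of [E] is the operator norm of the inverse of [B]. *)
pose E := [set rnorm x | x in [set x | V x /\ rnorm (B x) <= 1]].
have Eub : has_sup E.
  split.
    exists (rnorm (0 : H)); exists 0 => //.
    by split; [exact: V_subspace.1|rewrite B0 /rnorm normr0].
  exists k^-1 => _ [x [Vx Bx] <-]; rewrite -[leRHS]mulr1 ler_pdivlMl//.
  exact: le_trans (hk x Vx) Bx.
set t := sup E.
have Et q : E q -> q <= t by move=> Eq; apply: ub_le_sup => //; case: Eub.
have nBx0 : 0 < rnorm (B x0).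
  have x0n : 0 < rnorm x0 by have := rnorm_ge0 (B x0); nra.
  by apply: lt_le_trans (hk _ Vx0); rewrite mulr_gt0.
have tr : 1 < t * r.
  have /Et : E ((rnorm (B x0))^-1 * rnorm x0).
    exists (Cx (rnorm (B x0))^-1 *: x0); last by rewrite rnormZ ?invr_ge0 ?ltW.
    split; first exact: VZ.
    by rewrite BZ// rnormZ ?invr_ge0 ?(ltW nBx0)// mulVf ?gt_eqF.
  rewrite -(ler_pM2r r0); apply: lt_le_trans.
  by rewrite -mulrA ltr_pdivlMl// mulr1 mulrC.
have t0 : 0 < t by nra.
pose s := t^-1.
have s0 : 0 < s by rewrite invr_gt0.
have ts : t * s = 1 by rewrite mulfV ?gt_eqF.
have sr : s < r by rewrite -(ltr_pM2l t0) ts.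
have [|k1 k10 hk1] := Bs s; first by rewrite ger0_norm// ltW.
have [|k2 k20 hk2] := Bs (- s); first by rewrite normrN ger0_norm// ltW.
have Vt x : V x -> rnorm x <= t * rnorm (B x).
  move=> Vx; have [n0|n0] := eqVneq (rnorm (B x)) 0.
    by have := hk x Vx; rewrite n0 mulr0 pmulr_rle0.
  have n1 : 0 < rnorm (B x) by rewrite lt_neqAle eq_sym n0 rnorm_ge0.
  have /Et : E ((rnorm (B x))^-1 * rnorm x).
    exists (Cx (rnorm (B x))^-1 *: x); last by rewrite rnormZ ?invr_ge0 ?rnorm_ge0.
    split; first exact: VZ.
    by rewrite BZ// rnormZ ?invr_ge0 ?rnorm_ge0// mulVf.
  by rewrite ler_pdivrMl// mulrC.
pose K := (k2 * k1) ^+ 2.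
have K0 : 0 < K by rewrite exprn_gt0// mulr_gt0.
(* Take [y = B x] and [B w = x]. Then [y - s^2 w = (B - s) (B + s) w], so the two lower bounds and
   [q^2 = <w, y> <= |w|] give [k2 k1 q^2 <= |y - s^2 w|]. Expanding the square, with [|w| <= t q]
   and [t s = 1], bounds it above by [1 - s^2 q^2]. *)
have EK q : E q -> K * q ^+ 4 <= 1 - s ^+ 2 * q ^+ 2.
  move=> [x [Vx By] <-]; have [w Vw Bw] := Bsurj x.
  set q1 := rnorm x; set y := B x in By.
  have q10 : 0 <= q1 := rnorm_ge0 x.
  have wy : rdot w y = q1 ^+ 2 by rewrite /y -B_symmetric// Bw rdotxx.
  have wn : rnorm w <= t * q1 by rewrite /q1 -Bw Vt.
  have qw : q1 ^+ 2 <= rnorm w.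
    rewrite -wy; have := rdot_le w y; rewrite ler_norml => /andP[_ h].
    have := rnorm_ge0 w; nra.
  have Vv : V (x + Cx s *: w) by apply/VD/VZ.
  have h1 : k2 * k1 * q1 ^+ 2 <= rnorm (y - Cx (s ^+ 2) *: w).
    have := hk2 _ Vv; rewrite BD ?BZ//; last exact: VZ.
    rewrite Bw rmorphN scaleNr scalerDr scalerA -rmorphM/= -expr2 opprD addrA addrK.
    apply: le_trans; rewrite -mulrA ler_pM2l//.
    apply: le_trans (ler_wpM2l (ltW k10) qw) _.
    by rewrite -[x in rnorm (x + _)]Bw hk1.
  have h2 : rnorm (y - Cx (s ^+ 2) *: w) ^+ 2 <= 1 - s ^+ 2 * q1 ^+ 2.
    rewrite -rdotxx !rdotE (rdotC y w) wy !rdotxx.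
    have y2 : rnorm y ^+ 2 <= 1 by have := rnorm_ge0 y; nra.
    have w2 : s ^+ 2 * rnorm w ^+ 2 <= q1 ^+ 2.
      rewrite -exprMn ler_sqr ?nnegrE ?mulr_ge0 ?rnorm_ge0 ?(ltW s0)//.
      by rewrite -(ler_pM2l t0) mulrA ts mul1r.
    have := ler_wpM2l (sqr_ge0 s) w2; lra.
  apply: le_trans h2; rewrite /K -[4%N]/(2 * 2)%N exprM -exprMn.
  rewrite ler_sqr ?nnegrE ?rnorm_ge0//.
  by rewrite !mulr_ge0 ?sqr_ge0// ltW.
(* For [q >= t / 2], [EK] multiplied by [t^2] yields [D <= t^2 - q^2]. The [e] below is chosen so
   that some [q > t - e] in [E] also has [t^2 - q^2 < D], a contradiction. *)
pose D := K * t ^+ 6 / 16.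
have D0 : 0 < D by rewrite divr_gt0// mulr_gt0// exprn_gt0.
pose e := Num.min (t / 2) (D / (2 * t)).
have e0 : 0 < e.
  by rewrite lt_min; apply/andP; split; rewrite divr_gt0// mulr_gt0.
have [q Eq] := sup_adherent e0 Eub; rewrite -/t => qe.
have e1 : e <= t / 2 by rewrite ge_min lexx.
have e2 : 2 * t * e <= D.
  by rewrite mulrC -ler_pdivlMr ?mulr_gt0// ge_min lexx orbT.
have h1 : q ^+ 2 > t ^+ 2 - D.
  have : (t - e) ^+ 2 < q ^+ 2 by rewrite ltr_sqr ?nnegrE//; lra.
  have : 0 < e ^+ 2 by rewrite exprn_gt0.
  lra.
have q4 : t ^+ 4 / 16 <= q ^+ 4.
  have -> : t ^+ 4 / 16 = (t / 2) ^+ 4 by field.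
  by rewrite lerXn2r ?nnegrE//; lra.
have h2 := EK q Eq.
have h3 : K * (t ^+ 4 / 16) <= K * q ^+ 4 by rewrite ler_pM2l.
have h4 : t ^+ 2 * (K * (t ^+ 4 / 16)) <= t ^+ 2 * (1 - s ^+ 2 * q ^+ 2).
  by rewrite ler_pM2l ?exprn_gt0//; apply: le_trans h2.
have h5 : t ^+ 2 * (1 - s ^+ 2 * q ^+ 2) = t ^+ 2 - q ^+ 2.
  by rewrite mulrBr mulr1 mulrA -exprMn ts expr1n mul1r.
have h6 : t ^+ 2 * (K * (t ^+ 4 / 16)) = D by rewrite /D; field.
lra.
Qed.

(** Add the upper bound at [u + t x] to the lower bound at [u - t x]: the diagonal terms of the form
    cancel, leaving [2 t d <B u, x> <= |B u|^2 + t^2 |B x|^2] for every [t]. *)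
Lemma symmetric_polarization (d : R) : 0 < d ->
    (forall x, V x -> d * `|rdot (B x) x| <= rnorm (B x) ^+ 2) ->
  forall u x, V u -> V x -> d * `|rdot (B u) x| <= rnorm (B u) * rnorm (B x).
Proof.
move=> d0 h u x Vu Vx.
rewrite -{1}(ger0_norm (ltW d0)) -normrM.
rewrite -[leRHS]ger0_norm ?mulr_ge0 ?rnorm_ge0// -ler_sqr ?nnegrE//.
rewrite !real_normK ?num_real// [leRHS]exprMn -[leLHS]sqrrN.
apply: quadratic_ge0_discr => [|t]; first exact: sqr_ge0.
have xu : rdot (B x) u = rdot (B u) x by rewrite B_symmetric// rdotC.
have h1 := h _ (VD Vu (VZ t Vx)); have h2 := h _ (VD Vu (VZ (- t) Vx)).
have : d * rdot (B (u + Cx t *: x)) (u + Cx t *: x) <=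
       rnorm (B (u + Cx t *: x)) ^+ 2.
  by apply: le_trans h1; rewrite ler_pM2l// ler_norm.
have : - (d * rdot (B (u + Cx (- t) *: x)) (u + Cx (- t) *: x)) <=
       rnorm (B (u + Cx (- t) *: x)) ^+ 2.
  by apply: le_trans h2; rewrite -mulrN ler_pM2l// -normrN ler_norm.
rewrite !BD ?BZ//; try exact: VZ.
rewrite -!rdotxx !rdotE xu (rdotC (B x) (B u)); lra.
Qed.

End BoundedBelow.

(** * Unbounded operators *)

Section Operators.
Context {R : realType}.
Local Notation Cx a := (real_complex R a).

Lemma op_of_graphE (U : Type) (V : nmodType) (g : U -> V -> Prop) x y :
  g x y -> (forall y', g x y' -> y' = y) -> op_of_graph g x = y.
Proof. by move=> gxy u; apply: u; apply: (@xgetPex _ 0 [set y | g x y]); exists y. Qed.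

Lemma op_adjE (H G : hilbertType R) (L : operator H G) y z :
  (forall x, dom L x) -> adjoint_graph L y z -> op_adj L y = z.
Proof.
move=> Ld Lyz; apply: op_of_graphE => // z' Lyz'.
by apply: inner_ext => x; rewrite -Lyz// -Lyz'.
Qed.

Lemma inner_of_rdot (H G : hilbertType R) (x : H) (y : G) z w :
  rdot x z = rdot y w -> rdot ('i%C *: x) z = rdot ('i%C *: y) w ->
  inner x z = inner y w.
Proof. by rewrite !innerE => -> ->. Qed.

(** The real Riesz lemma represents [x |-> Re <L x, y>]; complex linearity of [L] supplies the
    identity at [i x]. *)
Lemma adjoint_exists (H G : hilbertType R) (L : operator H G) (c : R) y :
    linear_op L -> (forall x, dom L x) -> 0 <= c ->
    (forall x, rnorm (L x) <= c * rnorm x) ->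
  exists z, adjoint_graph L y z.
Proof.
move=> [_ _ lin] Ld c0 Lc.
have [//|a u v _ _||u _|z _ hz] :=
  @riesz_real R H setT (fun x => rdot (L x) y) (c * rnorm y) => //.
- by rewrite lin// !rdotE.
- by rewrite mulr_ge0 ?rnorm_ge0.
- apply: le_trans (rdot_le _ _) _.
  by rewrite -mulrA (mulrC (rnorm y)) mulrA ler_wpM2r ?rnorm_ge0.
exists z => x _; apply: inner_of_rdot; first exact: hz.
have L0 : L 0 = 0.
  by have := lin (-1) 0 0 (Ld _) (Ld _); rewrite !scaleN1r oppr0 add0r addNr.
have := lin 'i%C x 0 (Ld _) (Ld _); rewrite L0 !addr0 => <-; exact: hz.
Qed.

Section Linear.
Context {H G : hilbertType R} (L : operator H G) (Llin : linear_op L).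

Lemma linear_op0 : L 0 = 0.
Proof.
case: Llin => d0 _ lin.
by have := lin (-1) 0 0 d0 d0; rewrite !scaleN1r oppr0 add0r addNr.
Qed.

Lemma linear_opZ a x : dom L x -> L (a *: x) = a *: L x.
Proof.
case: Llin => d0 _ lin dx.
by have := lin a x 0 dx d0; rewrite linear_op0 !addr0.
Qed.

Lemma linear_opD x y : dom L x -> dom L y -> L (x + y) = L x + L y.
Proof. by case: Llin => _ _ lin dx dy; have := lin 1 x y dx dy; rewrite !scale1r. Qed.

Lemma linear_opN x : dom L x -> L (- x) = - L x.
Proof. by move=> dx; rewrite -scaleN1r linear_opZ// scaleN1r. Qed.

Lemma linear_opB x y : dom L x -> dom L y -> L (x - y) = L x - L y.
Proof.
case: Llin => _ _ lin dx dy; have := lin (-1) y x dy dx.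
by rewrite !scaleN1r addrC (addrC _ (L x)).
Qed.

Lemma linear_domZ a x : dom L x -> dom L (a *: x).
Proof. by case: Llin => d0 h _ dx; rewrite -[_ *: _]addr0; apply: h. Qed.

Lemma linear_domD x y : dom L x -> dom L y -> dom L (x + y).
Proof. by case: Llin => d0 h _ dx dy; rewrite -(scale1r x); apply: h. Qed.

Lemma linear_domB x y : dom L x -> dom L y -> dom L (x - y).
Proof.
by case: Llin => d0 h _ dx dy; rewrite -scaleN1r addrC; apply: h.
Qed.

End Linear.

Lemma op_neg_addE (H : hilbertType R) (A : operator H H) z x :
  op_neg_add A z x = - A x + z *: x.
Proof. by []. Qed.

Lemma linear_op_neg_add (H : hilbertType R) (A : operator H H) z :
  linear_op A -> linear_op (op_neg_add A z).
Proof.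
case=> d0 dl lin; split => // a x y dx dy /=.
rewrite lin// scalerDr !scalerA scalerDr scalerN scalerA opprD (mulrC z a).
by rewrite addrACA.
Qed.

Lemma linear_op_inv (H G : hilbertType R) (L : operator H G) :
    linear_op L -> (forall x, dom L x -> L x = 0 -> x = 0) ->
  linear_op (op_inv L) /\ forall x, dom L x -> op_inv L (L x) = x.
Proof.
move=> Ll inj.
have invK x : dom L x -> op_inv L (L x) = x.
  move=> dx; apply: op_of_graphE => // x' [dx' e].
  apply/eqP; rewrite -subr_eq0; apply/eqP/inj; first exact: linear_domB.
  by rewrite linear_opB// e subrr.
split=> //; case: (Ll) => d0 dl lin; split.
- by exists 0; split => //; rewrite linear_op0.
- move=> a _ _ [x [dx <-]] [y [dy <-]]; exists (a *: x + y).
  by split; [exact: dl|exact: lin].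
- move=> a _ _ [x [dx <-]] [y [dy <-]].
  by rewrite -lin// !invK//; exact: dl.
Qed.

Lemma linear_op_comp (H G K : hilbertType R) (M : operator G K) (L : operator H G) :
  linear_op M -> linear_op L -> linear_op (op_comp M L).
Proof.
move=> Mlin Llin; case: (Mlin) => m0 md ml; case: (Llin) => l0 ld ll; split.
- by split=> //; rewrite linear_op0.
- by move=> a x y [dx Dx] [dy Dy]; split; [exact: ld|rewrite ll//; exact: md].
- by move=> a x y [dx Dx] [dy Dy] /=; rewrite ll// ml.
Qed.

Section SelfAdjoint.
Context {H : hilbertType R} (A : operator H H).
Hypothesis A_sa : selfadjoint A.

Lemma selfadjoint_linear : linear_op A.
Proof. by case: A_sa. Qed.

Lemma selfadjoint_sym x y : dom A x -> dom A y -> inner (A x) y = inner x (A y).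
Proof.
case: A_sa => _ _ _ _ h dx dy.
by have [_] := h y (A y) I I; apply.
Qed.

Lemma selfadjointP y z :
  (forall x, dom A x -> inner (A x) y = inner x z) -> dom A y /\ A y = z.
Proof. by case: A_sa => _ _ _ _ h hyz; apply/(h y z I I). Qed.

Lemma eigenvalue_real lam : point_spectrum A lam -> exists l : R, lam = Cx l.
Proof.
case=> x [dx e] x0.
have := selfadjoint_sym dx dx; rewrite e innerZl innerZr => h.
have n0 : inner x x != 0 by apply: contra x0 => /eqP/inner_eq0 ->.
have {h} := mulIf n0 h; case: lam e => a b _ [h]; exists a.
by have -> : b = 0 by lra.
Qed.

Lemma resolvent_surj z y : resolvent_set A z ->
  exists2 x, dom A x & - A x + z *: x = y.
Proof. by case=> _ + _ => /seteqP[_ /(_ y I)] [x dx <-]; exists x. Qed.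

Lemma resolvent_bound z : resolvent_set A z ->
  exists2 k : R, 0 < k & forall x, dom A x -> rnorm x <= k * rnorm (- A x + z *: x).
Proof.
have Al := selfadjoint_linear; have Nl := linear_op_neg_add z Al.
move=> [inj _ cont].
have [Il IK] := linear_op_inv Nl inj.
have N0 : op_inv (op_neg_add A z) 0 = 0 by rewrite linear_op0.
have c0 : op_inv (op_neg_add A z) @ (0 : H) --> (0 : H).
  by rewrite -[X in _ --> X]N0; exact: cont.
have /nbhs_ballP[e /= e0 he] :=
  proj1 (cvg_rnormP (fmap_filter _ (nbhs_filter _)) _) c0 1 ltr01.
have eE : e = Cx (complex.Re e) by rewrite RRe_real// gtr0_real.
have d0 : 0 < complex.Re e by rewrite -ltcR -eE.
exists (2 / complex.Re e); first by rewrite divr_gt0.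
apply: (@homogeneous_bound _ _ (dom A) _ (fun x => rnorm (op_neg_add A z x))) => //.
- by move=> a x; apply: linear_domZ.
- by move=> a x a0 _; apply: rnormZ.
- by move=> a x a0 dx; rewrite (linear_opZ Nl)// rnormZ.
- by move=> x _; exact: rnorm_ge0.
move=> x dx xe.
have xb : ball (0 : H) e (op_neg_add A z x).
  by rewrite -ball_normE /ball_ /mkset sub0r normrN rnormE eE ltcR.
have : rnorm (0 - op_inv (op_neg_add A z) (op_neg_add A z x)) < 1 := he _ xb.
by rewrite IK// sub0r rnormN.
Qed.

Lemma graph_continuous_bound (G : hilbertType R) (tau : operator H G) :
    dom tau = dom A -> linear_op tau -> graph_continuous A tau ->
  exists2 k : R, 0 < k &
    forall x, dom A x -> rnorm (tau x) <= k * (rnorm x + rnorm (A x)).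
Proof.
have Al := selfadjoint_linear.
move=> td tl tc.
have d0 : dom A 0 by case: Al.
have [e e0 he] := tc 0 d0 1 ltr01.
have eE : e = Cx (complex.Re e) by rewrite RRe_real// gtr0_real.
have er0 : 0 < complex.Re e by rewrite -ltcR -eE.
exists (2 / complex.Re e); first by rewrite divr_gt0.
apply: (@homogeneous_bound _ _ (dom A) _ (fun x => rnorm x + rnorm (A x))) => //.
- by move=> a x; apply: linear_domZ.
- by move=> a x a0 dx; rewrite linear_opZ ?td// rnormZ.
- by move=> a x a0 dx; rewrite (linear_opZ Al)// !rnormZ// mulrDr.
- by move=> x _; rewrite addr_ge0 ?rnorm_ge0.
move=> x dx xe; have := he x dx.
rewrite linear_op0// !subr0 rnormE -(rmorph1 (real_complex R)) ltcR; apply.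
rewrite /graph_norm !rnormE -!rmorphXn -rmorphD /=.
rewrite -(@ltr_pXn2r _ 2)// ?nnegrE ?sqrtC_ge0 ?ler0c ?addr_ge0 ?sqr_ge0 ?(ltW e0)//.
rewrite sqrtCK eE -rmorphXn ltcR.
(* The graph norm is at most [|x| + |A x|], which is homogeneous and free of square roots. *)
apply: le_lt_trans (_ : (rnorm x + rnorm (A x)) ^+ 2 < _).
  by have := rnorm_ge0 x; have := rnorm_ge0 (A x); nra.
by rewrite ltr_sqr ?nnegrE ?addr_ge0 ?rnorm_ge0 ?(ltW er0).
Qed.

End SelfAdjoint.
End Operators.

(** * Reduced resolvent at an isolated eigenvalue *)

Section ReducedResolvent.
Context {R : realType} {H : hilbertType R} (A : operator H H) (l : R).
Local Notation Cx a := (real_complex R a).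
Hypothesis A_sa : selfadjoint A.

Local Notation N z := (op_neg_add A z).

Let Al : linear_op A := selfadjoint_linear A_sa.

Let Nl z : linear_op (N z) := linear_op_neg_add z Al.

Lemma op_neg_add_sym (s : R) x y : dom A x -> dom A y ->
  inner (N (Cx s) x) y = inner x (N (Cx s) y).
Proof.
move=> dx dy; rewrite /= innerDl innerNl innerDr innerNr innerZl innerZr.
by rewrite (selfadjoint_sym A_sa)// conjc_real.
Qed.

Lemma op_neg_add_shift (s t : R) x : N (Cx (s + t)) x = N (Cx s) x + Cx t *: x.
Proof. by rewrite /= rmorphD scalerDl addrA. Qed.

Lemma dom_real_subspace : real_subspace (dom A).
Proof. by case: Al => d0 d1 _; split=> // a x y; exact: d1. Qed.

Lemma op_neg_add_real_linear z : real_linear_on (dom A) (N z).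
Proof. by move=> a x y dx dy; case: (Nl z) => _ _; apply. Qed.

Lemma ran_real_subspace z : real_subspace (N z @` dom A).
Proof.
case: Al => dA0 dAD _; split; first by exists 0; rewrite ?(linear_op0 (Nl _)).
move=> a _ _ [u du <-] [v dv <-]; exists (Cx a *: u + v); first exact: dAD.
by case: (Nl z) => _ _; apply.
Qed.

Lemma op_neg_add_rdotC (s : R) x y : dom A x -> dom A y ->
  rdot (N (Cx s) x) y = rdot x (N (Cx s) y).
Proof. by move=> dx dy; rewrite /rdot op_neg_add_sym. Qed.

Lemma isolated_gap : isolated (spectrum A) (Cx l) ->
  exists2 d : R, 0 < d &
    forall x, dom A x -> d * `|rdot (N (Cx l) x) x| <= rnorm (N (Cx l) x) ^+ 2.
Proof.
move=> [_ [V /nbhs_ballP[e /= e0 eV] VE]].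
have eE : e = Cx (complex.Re e) by rewrite RRe_real// gtr0_real.
set d := complex.Re e in eE.
have d0 : 0 < d by rewrite -ltcR -eE.
have res s : 0 < `|s| < d -> resolvent_set A (Cx (l + s)).
  move=> /andP[s0 sd]; apply: contrapT => ns.
  have : (V `&` spectrum A) (Cx (l + s)).
    split=> //; apply: eV; rewrite -ball_normE /ball_ /mkset.
    by rewrite rmorphD opprD addNKr normrN normc_def /= expr0n addr0 sqrtr_sqr eE ltcR.
  rewrite VE => /complexI /eqP.
  by rewrite -subr_eq0 addrAC subrr add0r -normr_eq0 gt_eqF.
(* The open interval of radius [d / 2] about [l + c] has [l] as an endpoint and avoids the spectrum.
   Its gap reads [|N x + c x|^2 >= c^2 |x|^2] with [N = - A + l], and the terms [c^2 |x|^2]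
   cancel. *)
have side (c : R) : `|c| = d / 2 -> forall x, dom A x ->
    - (2 * c * rdot (N (Cx l) x) x) <= rnorm (N (Cx l) x) ^+ 2.
  move=> cd x dx.
  have cs s : `|s| < d / 2 -> resolvent_set A (Cx (l + c + s)).
    move=> sd; rewrite -addrA; apply: res.
    have h1 := ler_normD c s; have := ler_normB (c + s) s.
    rewrite addrK cd => h2; lra.
  have : d / 2 * rnorm x <= rnorm (N (Cx (l + c)) x).
    apply: (symmetric_gap dom_real_subspace (@op_neg_add_real_linear _)
      (op_neg_add_rdotC (l + c))) => // [y|s /cs rs].
      have [|z dz zy] := resolvent_surj y (cs 0 _); first by rewrite normr0; lra.
      by exists z => //; move: zy; rewrite addr0.
    have [k k0 hk] := resolvent_bound A_sa rs.
    exists k^-1; first by rewrite invr_gt0.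
    by move=> z dz; rewrite ler_pdivrMl// -op_neg_add_shift; exact: hk.
  have d2 : 0 <= d / 2 by lra.
  rewrite op_neg_add_shift -ler_sqr ?nnegrE ?rnorm_ge0 ?(mulr_ge0 d2 (rnorm_ge0 _))//.
  rewrite exprMn -!rdotxx !rdotE (rdotC x) -cd real_normK ?num_real//; lra.
exists d => // x dx.
have h1 := side (d / 2) _ x dx; have h2 := side (- (d / 2)) _ x dx.
rewrite -{1}(ger0_norm (ltW d0)) -normrM ler_norml; apply/andP; split.
  rewrite lerNl; apply: le_trans (h1 _); first by lra.
  by rewrite ger0_norm//; lra.
apply: le_trans (h2 _); first by lra.
by rewrite normrN ger0_norm//; lra.
Qed.

Context (P : {linear H -> H}).
Hypothesis P_proj : orthogonal_projection P.
Hypothesis P_range : range P = eigenspace_op A (Cx l).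

Lemma projection_eigenspace x : eigenspace_op A (Cx l) (P x).
Proof. by rewrite -P_range; exists x. Qed.

Lemma projection_id x : eigenspace_op A (Cx l) x -> P x = x.
Proof. by rewrite -P_range => -[y _ <-]; case: P_proj. Qed.

Lemma projection_compl x : orthoc (eigenspace_op A (Cx l)) (x - P x).
Proof.
move=> y /projection_id <-; rewrite P_proj.2 raddfB /= P_proj.1 subrr.
exact: inner0r.
Qed.

Lemma eigenspace_ker x : eigenspace_op A (Cx l) x -> N (Cx l) x = 0.
Proof. by move=> [_ e]; rewrite /= e addNr. Qed.

Variable d : R.
Hypothesis d0 : 0 < d.
Hypothesis gap : forall x, dom A x ->
  d * `|rdot (N (Cx l) x) x| <= rnorm (N (Cx l) x) ^+ 2.

(** Polarization bounds [v |-> <v, x>] on the range of [- A + l] by [|n| / d], and Riesz gives a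
    representative [z] with [|z| <= |n| / d]. Then [x - z] is orthogonal to that range, so by
    self-adjointness it is an eigenvector. As [x] is orthogonal to eigenvectors,
    [|x|^2 = <z, x>]. *)
Lemma reduced_bound x : dom A x -> orthoc (eigenspace_op A (Cx l)) x ->
  d * rnorm x <= rnorm (N (Cx l) x).
Proof.
move=> dx ox; set n := N (Cx l) x.
have [||||z zn hz] := @riesz_real R H (N (Cx l) @` dom A) (rdot^~ x) (rnorm n / d).
- exact: ran_real_subspace.
- by move=> a u v _ _; rewrite !rdotE.
- by rewrite divr_ge0 ?rnorm_ge0 ?ltW.
- move=> _ [u du <-]; rewrite mulrAC ler_pdivlMr// mulrC [leRHS]mulrC.
  apply: (@symmetric_polarization _ _ _ _ dom_real_subspace
    (@op_neg_add_real_linear _) (op_neg_add_rdotC l)) => //.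
have [dk Ak] : dom A (x - z) /\ A (x - z) = Cx l *: (x - z).
  apply: (selfadjointP A_sa) => u du.
  have h (v : H) : dom A v -> rdot (N (Cx l) v) (x - z) = rdot (0 : H) (0 : H).
    move=> dv; rewrite rdotDr rdotNr -hz; last by exists v.
    by rewrite subrr /rdot inner0l.
  have := @inner_of_rdot _ _ _ (N (Cx l) u) (0 : H) (x - z) 0 (h u du).
  rewrite scaler0 -(linear_opZ (Nl _))// => /(_ (h _ (linear_domZ Al 'i%C du))).
  rewrite inner0r /= innerDl innerNl innerZl innerZr conjc_real addrC => /eqP.
  by rewrite subr_eq0 => /eqP.
have := ox _ (conj dk Ak); rewrite innerDl innerNl => /eqP; rewrite subr_eq0 => /eqP e.
have : rnorm x ^+ 2 <= rnorm n / d * rnorm x.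
  rewrite -rdotxx /rdot e -/(rdot z x).
  apply: le_trans (ler_norm _) (le_trans (rdot_le _ _) _).
  by rewrite ler_wpM2r ?rnorm_ge0.
have [->|x0] := eqVneq (rnorm x) 0; first by rewrite !mulr0 rnorm_ge0.
have xp : 0 < rnorm x by rewrite lt_neqAle eq_sym x0 rnorm_ge0.
rewrite expr2 ler_pM2r//.
by rewrite ler_pdivlMr// mulrC.
Qed.

(** The functional [N u |-> <u, y>] is well defined because [y] is orthogonal to the kernel of [N],
    and bounded by [reduced_bound]. Its representative [z] satisfies [N z = y] by self-adjointness;
    removing [P z] makes it orthogonal to the eigenspace. *)
Lemma reduced_surj y : orthoc (eigenspace_op A (Cx l)) y ->
  exists x, [/\ dom A x, orthoc (eigenspace_op A (Cx l)) x & N (Cx l) x = y].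
Proof.
move=> oy.
have wd u u' : dom A u -> dom A u' -> N (Cx l) u = N (Cx l) u' -> rdot u y = rdot u' y.
  move=> du du' e; apply/eqP; rewrite -subr_eq0 -rdotNl -rdotDl /rdot oy//.
  split; first exact: linear_domB.
  have : N (Cx l) (u - u') = 0 by rewrite (linear_opB (Nl _))// e subrr.
  by rewrite /= addrC => /eqP; rewrite subr_eq0 => /eqP.
(* [g] picks some preimage under [N]; the default 0 occurs only off the range, and by [wd] the
   choice does not affect [<g v, y>]. *)
pose g v := xget 0 [set u | dom A u /\ N (Cx l) u = v].
have gP u : dom A u -> rdot (g (N (Cx l) u)) y = rdot u y.
  move=> du; have [dg eg] :
      [set u' | dom A u' /\ N (Cx l) u' = N (Cx l) u] (g (N (Cx l) u)).
    by apply: (xgetPex 0); exists u.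
  exact: wd.
have [||||z zn hz] := @riesz_real R H (N (Cx l) @` dom A)
  (fun v => rdot (g v) y) (rnorm y / d).
- exact: ran_real_subspace.
- move=> a _ _ [u du <-] [v dv <-].
  have <- : N (Cx l) (Cx a *: u + v) = Cx a *: N (Cx l) u + N (Cx l) v.
    by case: (Nl (Cx l)) => _ _; apply.
  by rewrite !gP ?rdotE//; case: Al => _ + _; apply.
- by rewrite divr_ge0 ?rnorm_ge0 ?ltW.
- move=> _ [u du <-]; rewrite gP//.
  have [dP eP] := projection_eigenspace u.
  have -> : rdot u y = rdot (u - P u) y.
    by rewrite rdotDl rdotNl {3}/rdot oy// subr0.
  have NuP : N (Cx l) (u - P u) = N (Cx l) u.
    by rewrite (linear_opB (Nl _))// (eigenspace_ker (conj dP eP)) subr0.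
  have := reduced_bound (linear_domB Al du dP) (projection_compl u).
  rewrite NuP -ler_pdivlMl// => h.
  apply: le_trans (rdot_le _ _) _; rewrite mulrC -mulrA.
  by rewrite ler_wpM2l ?rnorm_ge0.
have [dz Az] : dom A z /\ A z = Cx l *: z - y.
  apply: (selfadjointP A_sa) => u du.
  have h v : dom A v -> rdot (N (Cx l) v) z = rdot v y.
    by move=> dv; rewrite -hz ?gP//; exists v.
  have := @inner_of_rdot _ _ _ (N (Cx l) u) u z y (h u du).
  rewrite -(linear_opZ (Nl _))// => /(_ (h _ (linear_domZ Al 'i%C du))).
  rewrite /= innerDl innerNl innerZl innerDr innerNr innerZr conjc_real => <-.
  by rewrite opprD opprK addrCA subrr addr0.
have [dP eP] := projection_eigenspace z.
exists (z - P z); split; [exact: linear_domB|exact: projection_compl|].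
rewrite (linear_opB (Nl _))// (eigenspace_ker (conj dP eP)) subr0 /= Az.
by rewrite opprB subrK.
Qed.

End ReducedResolvent.

(** * Dimension *)

Section Dimension.
Local Open Scope card_scope.
Context {K : numFieldType}.

Definition linear_subset (U : lmodType K) (V : set U) : Prop :=
  V 0 /\ forall a x y, V x -> V y -> V (a *: x + y).

Definition free_set (U : lmodType K) (B : set U) : Prop :=
  forall (s : seq U) (c : U -> K), uniq s -> [set` s] `<=` B ->
    \sum_(u <- s) c u *: u = 0 -> forall u, u \in s -> c u = 0.

(** Induction on [s], keeping the larger of two comparable members. The case [s = [::]] is separate
    because the chain may be empty. *)
Lemma chain_bigcup_seq (T : eqType) (F : set (set T)) (s : seq T) :
    total_on F subset -> [set` s] `<=` \bigcup_(X in F) X ->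
  s = [::] \/ exists2 X, F X & [set` s] `<=` X.
Proof.
move=> Ftot; elim: s => [|x s IH] sF; first by left.
right; have [X FX Xx] := sF x (mem_head _ _).
have [|s0|[Y FY sY]] := IH; first by move=> y /= ys; apply: sF; rewrite /= inE ys orbT.
  by exists X => // y; rewrite /= s0 inE => /eqP ->.
have [XY|YX] := Ftot X Y FX FY.
  by exists Y => // y; rewrite /= inE => /orP[/eqP ->|/sY//]; exact: XY.
by exists X => // y; rewrite /= inE => /orP[/eqP ->//|/sY]; exact: YX.
Qed.

(** Zorn on the free subsets of [V]: a vector outside the span of a maximal one could be adjoined to
    it. *)
Lemma exists_basis (U : lmodType K) (V : set U) :
  linear_subset V -> exists B, is_basis V B.
Proof.
move=> [V0 VD].
have [F FP Ftot|B [[BV Bfree] Bmax]] :=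
  @Zorn_bigcup U [set B | B `<=` V /\ free_set B].
  split=> [x [X /FP[XV _] /XV]//|s c us sF s0].
  have [->//|[X FX sX]] := chain_bigcup_seq Ftot sF.
  by have [_ Xfree] := FP X FX; exact: Xfree.
exists B; split => // v Vv.
have [Bv|nBv] := pselect (B v).
  exists [:: v], (fun=> 1); split; last by rewrite big_seq1 scale1r.
  by move=> x; rewrite /= inE => /eqP ->.
have /not_andP[] : ~ (B `|` [set v] `<=` V /\ free_set (B `|` [set v])).
- by apply: Bmax; split=> [x|]; [left|move/(_ v (or_intror erefl))].
- by case=> x [/BV//|->].
move=> nfree; apply: contrapT => nspan; apply: nfree => s c us sB s0.
have [vs|vs] := boolP (v \in s); last first.
  apply: Bfree => // x xs; have [//|xv] := sB x xs.
  by move: vs; rewrite -xv [x \in s]xs.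
have sB' : [set` rem v s] `<=` B.
  move=> x; rewrite /= mem_rem_uniq// inE => /andP[xv xs].
  by have [//|/= e] := sB x xs; rewrite e eqxx in xv.
move: s0; rewrite (big_rem v)//= => s0.
have [cv|cv] := eqVneq (c v) 0.
  have c0 : forall u, u \in rem v s -> c u = 0.
    by apply: Bfree; rewrite ?rem_uniq//; move: s0; rewrite cv scale0r add0r.
  move=> u us'; have [->//|uv] := eqVneq u v.
  by apply: c0; rewrite mem_rem_uniq// inE uv.
(* A relation with [c v] nonzero can be solved for [v], which puts [v] in the span of [B]. *)
case: nspan; exists (rem v s), (fun u => - (c v)^-1 * c u); split => //.
under eq_bigr do rewrite -scalerA; rewrite -scaler_sumr scaleNr -scalerN.
move/eqP: s0; rewrite addr_eq0 => /eqP e.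
by rewrite -e scalerA mulVf// scale1r.
Qed.

(** An injective linear map carries a basis of [V] to a basis of the image; coefficients are
    transported by the inverse [g] of [f] on the basis. *)
Lemma same_dim_image (U1 U2 : lmodType K) (V : set U2) (f : U2 -> U1) :
    linear_subset V ->
    (forall a x y, V x -> V y -> f (a *: x + y) = a *: f x + f y) ->
    (forall x, V x -> f x = 0 -> x = 0) ->
  same_dim (f @` V) V.
Proof.
move=> Vl fl f0; have [B [BV Bfree Bspan]] := exists_basis Vl.
have [V0 VD] := Vl.
have f00 : f 0 = 0.
  by have := fl (-1) 0 0 V0 V0; rewrite !scaleN1r oppr0 add0r addNr.
have finj x y : V x -> V y -> f x = f y -> x = y.
  move=> Vx Vy e; apply/eqP; rewrite -subr_eq0 addrC -scaleN1r; apply/eqP/f0.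
    exact: VD.
  by rewrite fl// e scaleN1r addNr.
have Vsum (s : seq U2) (c : U2 -> K) : [set` s] `<=` V ->
    V (\sum_(x <- s) c x *: x) /\
    f (\sum_(x <- s) c x *: x) = \sum_(x <- s) c x *: f x.
  elim: s => [|x s IH] sV; first by rewrite !big_nil.
  have [|Vs es] := IH; first by move=> y ys; apply: sV; rewrite /= inE [y \in s]ys orbT.
  have Vx : V x by apply: sV; rewrite /= mem_head.
  by rewrite !big_cons; split; [exact: VD|rewrite fl// es].
pose g w := xget 0 [set u | B u /\ f u = w].
have gP w : (f @` B) w -> B (g w) /\ f (g w) = w.
  by move=> [u Bu <-]; apply: (@xgetPex _ 0 [set u' | B u' /\ f u' = f u]); exists u.
have gf u : B u -> g (f u) = u.
  move=> Bu; have [Bg e] := gP (f u) (ex_intro2 _ _ u Bu erefl).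
  by apply: finj => //; exact: BV.
exists (f @` B), B; split => //; last first.
- by apply: inj_card_eq => x y /set_mem Bx /set_mem By; apply: finj; exact: BV.
split.
- by move=> _ [x Bx <-]; exists x => //; exact: BV.
- move=> s c us sB s0 w ws.
  have gB : [set` map g s] `<=` B.
    by move=> _ /= /mapP[x xs ->]; have [] := gP x (sB x xs).
  have gu : uniq (map g s).
    rewrite map_inj_in_uniq// => x y xs ys e.
    by rewrite -(gP x (sB x xs)).2 e (gP y (sB y ys)).2.
  have [Vs es] := Vsum (map g s) (c \o f) (subset_trans gB BV).
  have : \sum_(u <- map g s) (c \o f) u *: u = 0.
    apply: f0 => //; rewrite es big_map -[RHS]s0 !big_seq.
    by apply: eq_bigr => x xs /=; rewrite (gP x (sB x xs)).2.
  move=> /(Bfree _ _ gu gB) /(_ (g w)) /=.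
  by rewrite (gP w (sB w ws)).2; apply; apply: map_f.
- move=> _ [v Vv <-]; have [s [c [sB e]]] := Bspan v Vv.
  exists (map f s), (c \o g); split.
    by move=> _ /= /mapP[x xs ->]; exists x => //; exact: sB.
  rewrite e (Vsum _ _ (subset_trans sB BV)).2 big_map !big_seq.
  by apply: eq_bigr => x xs /=; rewrite gf//; exact: sB.
Qed.

End Dimension.

(** * Eigenspaces of the extension *)

Section Adjoint.
Context {R : realType} {H G : hilbertType R} (L : operator H G).
Hypothesis L_total : forall x, dom L x.
Hypothesis L_adj : forall y, exists z, adjoint_graph L y z.

Lemma op_adjP y : adjoint_graph L y (op_adj L y).
Proof. by have [z hz] := L_adj y; rewrite (op_adjE L_total hz). Qed.

Lemma op_adj_linear a y y' :
  op_adj L (a *: y + y') = a *: op_adj L y + op_adj L y'.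
Proof.
apply: op_adjE => // x dx; rewrite !innerDr !innerZr.
by rewrite !(op_adjP _ dx).
Qed.

Lemma op_adj0 : op_adj L 0 = 0.
Proof.
have := op_adj_linear (-1) 0 0.
by rewrite !scaleN1r oppr0 add0r addNr.
Qed.

End Adjoint.

Section Orthoc.
Context {R : realType} {H : hilbertType R} (S : set H).

Lemma linear_subset_orthoc : linear_subset (orthoc S).
Proof.
split=> [x _|a x y ox oy z Sz]; first exact: inner0r.
by rewrite innerDr innerZr ox// oy// mulr0 addr0.
Qed.

End Orthoc.

Section Extension.
Context {R : realType} {H h : hilbertType R}.
Local Notation Cx a := (real_complex R a).
Context (A : operator H H) (tau : operator H h).
Hypothesis A_sa : selfadjoint A.
Hypothesis A_res0 : resolvent_set A 0.
Hypothesis tau_dom : dom tau = dom A.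
Hypothesis tau_lin : linear_op tau.
Hypothesis tau_cont : graph_continuous A tau.

Let Al : linear_op A := selfadjoint_linear A_sa.

Let dom_tau u : dom A u -> dom tau u.
Proof. by rewrite tau_dom. Qed.

Lemma resolvent0_surj y : exists2 u, dom A u & - A u = y.
Proof.
by have [u du] := resolvent_surj y A_res0; rewrite scale0r addr0; exists u.
Qed.

Lemma resolvent0_inj u : dom A u -> A u = 0 -> u = 0.
Proof.
by case: A_res0 => inj _ _ du e; apply: inj; rewrite //= e scale0r oppr0 addr0.
Qed.

Local Notation T := (op_comp tau (op_inv (op_neg_add A (Num.conj 0)))).

(** Every vector is [- A u] for some [u], so this parametrization eliminates the inverse from the
    later computations. *)
Lemma trace_resolventE u : dom A u -> dom T (- A u) /\ T (- A u) = tau u.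
Proof.
rewrite conjC0 => du.
case: A_res0 => inj _ _.
have [_ IK] := linear_op_inv (linear_op_neg_add 0 Al) inj.
have e : op_inv (op_neg_add A 0) (- A u) = u.
  by have := IK u du; rewrite [in X in op_inv _ X]/= scale0r addr0.
split; last exact: congr1 e.
split; last by move: (dom_tau du); rewrite -{1}e.
by exists u; split=> //=; rewrite scale0r addr0.
Qed.

Lemma trace_resolvent_total x : dom T x.
Proof. by have [u du <-] := resolvent0_surj x; case: (trace_resolventE du). Qed.

Lemma trace_resolvent_adj xi : exists z, adjoint_graph T xi z.
Proof.
have [k k0 hk] := resolvent_bound A_sa A_res0.
have [c c0 hc] := graph_continuous_bound A_sa tau_dom tau_lin tau_cont.
(* From [|u| <= k |A u|] the graph bound [c (|u| + |A u|)] becomes [c (k + 1) |A u|]. *)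
apply: (@adjoint_exists _ _ _ _ (c * (k + 1))).
- apply: linear_op_comp => //; rewrite conjC0.
  case: A_res0 => inj _ _.
  by have [] := linear_op_inv (linear_op_neg_add 0 Al) inj.
- exact: trace_resolvent_total.
- by rewrite mulr_ge0 ?addr_ge0 ?ltW.
move=> x; have [u du <-] := resolvent0_surj x.
rewrite (trace_resolventE du).2; apply: le_trans (hc u du) _.
rewrite -mulrA ler_pM2l// mulrDl mul1r rnormN lerD2r.
by have := hk u du; rewrite scale0r addr0 rnormN.
Qed.

Local Notation G0 := (Gop A tau 0).

Lemma GopP xi u : dom A u -> inner (tau u) xi = inner (- A u) (G0 xi).
Proof.
move=> du; have [dT <-] := trace_resolventE du.
exact: (op_adjP trace_resolvent_total trace_resolvent_adj).
Qed.

Lemma Gop_linear a xi xi' : G0 (a *: xi + xi') = a *: G0 xi + G0 xi'.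
Proof. exact: (op_adj_linear trace_resolvent_total trace_resolvent_adj). Qed.

Lemma Gop0 : G0 0 = 0.
Proof. exact: (op_adj0 trace_resolvent_total trace_resolvent_adj). Qed.

Lemma Gop_total xi : dom G0 xi.
Proof. exact: trace_resolvent_adj. Qed.

Lemma Gop_adj_graph u : dom A u -> adjoint_graph G0 (- A u) (tau u).
Proof. by move=> du xi _; rewrite innerC -GopP// -innerC. Qed.

(** So the adjoint of [G0] is the trace of the inverse of [- A], which evaluates the extra term in
    the boundary condition of [Nset]. *)
Lemma Gop_adjE u : dom A u -> op_adj G0 (- A u) = tau u.
Proof. by move=> du; apply: (op_adjE Gop_total); exact: Gop_adj_graph. Qed.

Hypothesis tau_surj : ran tau = setT.
Hypothesis tau_ker : dense (op_ker tau).

(** For nonzero [x] the ball about [x] of radius [|x|] meets [S], but by Pythagoras vectors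
    orthogonal to [x] are at distance at least [|x|]. *)
Lemma dense_orthogonal (S : set H) x : dense S ->
  (forall y, S y -> inner y x = 0) -> x = 0.
Proof.
move=> Sd ox; apply: rnorm_eq0; apply/eqP; rewrite eq_le rnorm_ge0 andbT.
rewrite leNgt; apply/negP => x0.
have x0' : 0 < Cx (rnorm x) by rewrite ltcR.
have [||y [xy Sy]] := Sd (ball x (Cx (rnorm x))).
- by exists x; exact: ballxx.
- exact: ball_open.
move: xy; rewrite -ball_normE /ball_ /mkset rnormE ltcR.
have yx0 : rdot y x = 0 by rewrite /rdot ox.
rewrite -ltr_sqr ?nnegrE ?rnorm_ge0// -!rdotxx !rdotE (rdotC x) yx0 !rdotxx.
have := sqr_ge0 (rnorm y); lra.
Qed.

(** For [u] in the kernel of [tau], [<u, A (G0 xi)> = - <tau u, xi> = 0], so density gives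
    [A (G0 xi) = 0] and [G0 xi = 0]. Then [xi] is orthogonal to the range of [tau], which is
    everything. *)
Lemma Gop_dom0 xi : dom A (G0 xi) -> xi = 0.
Proof.
move=> dG; have AG0 : A (G0 xi) = 0.
  apply: (dense_orthogonal tau_ker) => u [du tu].
  rewrite tau_dom in du; rewrite -(selfadjoint_sym A_sa)//.
  by rewrite -[A u]opprK innerNl -GopP// tu inner0l oppr0.
have G00 := resolvent0_inj dG AG0.
apply: inner_ext => y; rewrite inner0r.
have [u du <-] : ran tau y by rewrite tau_surj.
by rewrite GopP -?tau_dom// G00 inner0r.
Qed.

Context (Pi : {linear h -> h}) (Theta : operator h h).
Local Notation L := (extension A tau Pi Theta).

(** Two decompositions of [phi] differ by an element of the range of [G0] lying in [dom A], so
    [Gop_dom0] makes them equal and the value chosen by [op_of_graph] is [A phi0]. *)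
Lemma extension_eigenspaceP lam phi : linear_op Theta ->
  eigenspace_op L lam phi <-> exists phi0 xi,
    [/\ dom A phi0, dom Theta xi, Pi (tau phi0) = Theta xi,
        phi = phi0 + G0 xi & A phi0 = lam *: phi].
Proof.
move=> Thl.
have LE phi0 xi : dom A phi0 -> dom Theta xi -> Pi (tau phi0) = Theta xi ->
    L (phi0 + G0 xi) = A phi0.
  move=> d0 dxi e; apply: op_of_graphE; first by exists phi0, xi.
  move=> w [phi0' [xi' [d0' dxi' _ e' ->]]]; congr (A _).
  have eG : G0 (-1 *: xi' + xi) = phi0' - phi0.
    rewrite Gop_linear scaleN1r; apply/eqP; rewrite eq_sym subr_eq -addrA.
    by rewrite (addrC (G0 xi)) e' addrC addrK.
  have /Gop_dom0 : dom A (G0 (-1 *: xi' + xi)) by rewrite eG; exact: linear_domB.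
  move=> x0; move: eG; rewrite x0.
  rewrite Gop0 => /eqP.
  by rewrite eq_sym subr_eq0 => /eqP.
split.
  move=> [[w [phi0 [xi [d0 dxi e -> _]]]]]; rewrite LE// => eA.
  by exists phi0, xi.
move=> [phi0 [xi [d0 dxi e -> eA]]]; split; last by rewrite LE.
by exists (A phi0), phi0, xi.
Qed.

Context (l : R) (P : {linear H -> H}).
Hypothesis P_proj : orthogonal_projection P.
Hypothesis P_range : range P = eigenspace_op A (Cx l).
Local Notation RanTauP := (ran (op_comp tau (total_op P))).

Lemma ran_trace_projection psi : eigenspace_op A (Cx l) psi -> RanTauP (tau psi).
Proof.
move=> epsi; exists psi => /=; rewrite (projection_id P_proj P_range epsi)//.
by split=> //; apply: dom_tau; case: epsi.
Qed.

(* Pairing the eigenvalue equation with an eigenvector [psi] of [A] kills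
   [phi0], leaving [<tau psi, xi> = 0]. *)
Lemma eigenvector_charge_orthogonal phi0 xi : dom A phi0 ->
  A phi0 = Cx l *: (phi0 + G0 xi) -> orthoc RanTauP xi.
Proof.
move=> d0 e _ [x [_ dx] <-] /=.
have [dP eP] := projection_eigenspace P_range x.
rewrite GopP// eP -scalerN innerZl innerNl mulrN -mulNr.
have := selfadjoint_sym A_sa dP d0.
rewrite eP e innerZl innerZr conjc_real innerDr => /eqP.
by rewrite mulrDr -subr_eq0 opprD addrA subrr add0r mulNr => /eqP.
Qed.

(** * Eigenvectors of the extension under a spectral gap at the eigenvalue *)

Section Isolated.
Variable d : R.
Hypothesis d0 : 0 < d.
Hypothesis gap : forall x, dom A x ->
  d * `|rdot (op_neg_add A (Cx l) x) x| <= rnorm (op_neg_add A (Cx l) x) ^+ 2.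

Local Notation E := (eigenspace_op A (Cx l)).
Local Notation N := (op_neg_add A (Cx l)).
Local Notation inv := (op_inv (op_restr N (orthoc E))).
Local Notation T2 := (op_comp tau (op_comp inv (total_op (fun x => x - P x)))).

Let Nl : linear_op N := linear_op_neg_add (Cx l) Al.

Lemma linear_op_reduced :
  linear_op inv /\ forall u, dom A u -> orthoc E u -> inv (N u) = u.
Proof.
have [oE0 oED] := linear_subset_orthoc E.
case: (Al) => dA0 dAD _.
have [||Il IK] := @linear_op_inv _ _ _ (op_restr N (orthoc E)).
- split=> [//|a x y [dx ox] [dy oy]|a x y [dx _] [dy _]].
    by split; [exact: dAD|exact: oED].
  by case: Nl => _ _; apply.
- move=> x [dx ox] e; apply: rnorm_eq0; apply/eqP; rewrite eq_le rnorm_ge0 andbT.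
  have := reduced_bound A_sa d0 gap dx ox.
  have -> : N x = 0 := e.
  by rewrite {2}/rnorm normr0 pmulr_rle0.
by split=> // u du ou; apply: IK.
Qed.

Lemma trace_reduced x :
  exists u, [/\ dom A u, orthoc E u, N u = x - P x, dom T2 x & T2 x = tau u].
Proof.
have [u [du ou eu]] := reduced_surj A_sa P_proj P_range d0 gap
  (projection_compl P_proj P_range x).
have [_ IK] := linear_op_reduced.
have e : inv (x - P x) = u by rewrite -eu IK.
exists u; split => //; last exact: congr1 e.
split; last by move: (dom_tau du); rewrite -{1}e.
by split => //; exists u; split.
Qed.

Lemma Gperp_adj xi : exists z, adjoint_graph T2 xi z.
Proof.
have [c c0 hc] := graph_continuous_bound A_sa tau_dom tau_lin tau_cont.
(* With [y = x - P x], the bounds [|u| <= |y| / d], [|A u| <= |l| |u| + |y|] and [|y| <= |x|] give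
   [|u| + |A u| <= (d^-1 (1 + |l|) + 1) |x|]. *)
have dl0 : 0 <= d^-1 * (1 + `|l|) + 1.
  by rewrite addr_ge0// mulr_ge0 ?invr_ge0 ?addr_ge0// ltW.
apply: (@adjoint_exists _ _ _ _ (c * (d^-1 * (1 + `|l|) + 1))).
- apply: linear_op_comp => //; apply: linear_op_comp; first exact: linear_op_reduced.1.
  split=> // a x y _ _ /=; rewrite linearP scalerBr opprD addrACA //.
- by move=> x; have [u []] := trace_reduced x.
- by rewrite mulr_ge0// ltW.
move=> x; have [u [du ou Nu _ ->]] := trace_reduced x.
apply: le_trans (hc u du) _; rewrite -mulrA ler_pM2l//.
set y := x - P x in Nu.
have yx : rnorm y <= rnorm x.
  have oy : rdot (P x) y = 0.
    by rewrite /rdot (projection_compl P_proj P_range)//; exact: projection_eigenspace.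
  have : rnorm y ^+ 2 <= rnorm x * rnorm y.
    rewrite -rdotxx {1}/y rdotDl rdotNl oy subr0.
    exact: le_trans (ler_norm _) (rdot_le _ _).
  have [->|y0] := eqVneq (rnorm y) 0; first by rewrite rnorm_ge0.
  have yp : 0 < rnorm y by rewrite lt_neqAle eq_sym y0 rnorm_ge0.
  by rewrite expr2 ler_pM2r.
have uy : rnorm u <= d^-1 * rnorm y.
  by rewrite ler_pdivlMl// -Nu; exact: (reduced_bound A_sa d0 gap).
have Au : rnorm (A u) <= `|l| * rnorm u + rnorm y.
  have -> : A u = Cx l *: u - y by rewrite -Nu /= opprD opprK addrCA subrr addr0.
  apply: le_trans (rnormD _ _) _; rewrite rnormN lerD2r.
  have -> : rnorm (Cx l *: u) = `|l| * rnorm u; last by [].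
  apply: complexI; rewrite rmorphM /= -!rnormE normrZ; congr (_ * _).
  by rewrite normc_def /= expr0n addr0 sqrtr_sqr.
have := ler_wpM2l dl0 yx; apply: le_trans.
rewrite mulrDl mul1r mulrAC mulrDr mulr1 mulrC (mulrC _ `|l|).
have := ler_wpM2l (normr_ge0 l) uy; lra.
Qed.

Local Notation Gp := (Gperp A tau (Cx l) P).

Lemma Gperp_total x : dom T2 x.
Proof. by have [u []] := trace_reduced x. Qed.

Lemma Gperp_linear a xi xi' : Gp (a *: xi + xi') = a *: Gp xi + Gp xi'.
Proof. exact: (op_adj_linear Gperp_total Gperp_adj). Qed.

Lemma GperpP xi x u : dom A u -> orthoc E u -> N u = x - P x ->
  inner (tau u) xi = inner x (Gp xi).
Proof.
move=> du ou Nu; rewrite -(op_adjP Gperp_total Gperp_adj)//; last exact: Gperp_total.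
have e : inv (x - P x) = u by rewrite -Nu linear_op_reduced.2.
by rewrite -[in LHS]e.
Qed.

Lemma Gperp_orthoc xi : orthoc E (Gp xi).
Proof.
move=> x Ex; rewrite -(@GperpP xi x 0); first by rewrite linear_op0// inner0l.
- by case: Al.
- exact: (linear_subset_orthoc E).1.
- by rewrite (projection_id P_proj P_range Ex) subrr linear_op0.
Qed.

(** [N u] is orthogonal to the eigenspace by symmetry, so [u - P u] is exactly the reduced resolvent
    applied to [N u]. *)
Lemma Gperp_trace xi u : dom A u ->
  inner (tau (u - P u)) xi = inner (N u) (Gp xi).
Proof.
move=> du; have [dP eP] := projection_eigenspace P_range u.
have PN : P (N u) = 0.
  apply: inner_ext => y; rewrite -P_proj.2 inner0r.
  have [dy ey] := projection_eigenspace P_range y.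
  by rewrite -op_neg_add_sym// (eigenspace_ker (conj dy ey)) inner0l.
apply: GperpP; [exact: linear_domB|exact: (projection_compl P_proj P_range)|].
by rewrite (linear_opB Nl)// (eigenspace_ker (conj dP eP)) PN.
Qed.

(** When [xi] is orthogonal to [tau (P u)], computing [<tau u, xi>] through both operators gives
    [<- A u, G0 xi> = <- A u + l u, Gp xi>]. This is the adjoint relation for [Gp xi - G0 xi], and
    self-adjointness concludes. *)
Lemma Gperp_Gop xi : orthoc RanTauP xi ->
  dom A (Gp xi - G0 xi) /\ A (Gp xi - G0 xi) = Cx l *: Gp xi.
Proof.
move=> oxi; apply: (selfadjointP A_sa) => u du.
have [dP eP] := projection_eigenspace P_range u.
have := Gperp_trace xi du.
rewrite (linear_opB tau_lin) ?tau_dom// innerDl innerNl (GopP _ du).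
rewrite (oxi (tau (P u))); last by apply: ran_trace_projection.
rewrite subr0 op_neg_addE innerDl !innerNl innerZl
  innerDr innerNr innerZr conjc_real => e.
by rewrite e addrA subrr add0r.
Qed.

(** Write [Gp xi = - A u]. Then [A] kills [eta + l u], so [l u = - eta], and applying [tau] gives
    the claim by [Gop_adjE]. *)
Lemma Gperp_Gop_trace xi : orthoc RanTauP xi ->
  Cx l *: op_adj G0 (Gp xi) = - tau (Gp xi - G0 xi).
Proof.
move=> /Gperp_Gop; set eta := _ - _ => -[deta Aeta].
have [u du Au] := resolvent0_surj (Gp xi).
rewrite -Au Gop_adjE//.
have e0 : eta + Cx l *: u = 0.
  have dlu := linear_domZ Al (Cx l) du.
  apply: resolvent0_inj; first exact: linear_domD.
  by rewrite linear_opD// linear_opZ// Aeta -Au scalerN addNr.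
move/eqP: e0; rewrite addrC addr_eq0 => /eqP e0.
rewrite -(linear_opZ tau_lin) ?tau_dom// e0 (linear_opN tau_lin)//.
by rewrite tau_dom.
Qed.

Lemma Gperp_eq0 xi : orthoc RanTauP xi -> Gp xi = 0 -> xi = 0.
Proof.
move=> /Gperp_Gop[+ _] Gp0; rewrite Gp0 sub0r => dG.
by apply: Gop_dom0; rewrite -[G0 xi]opprK -scaleN1r; exact: linear_domZ.
Qed.

Hypothesis Pi_proj : orthogonal_projection Pi.
Hypothesis Theta_sa : selfadjoint_in (range Pi) Theta.
Local Notation Ns := (Nset A tau Pi Theta (Cx l) P).
Let f (p : H * h) := p.1 + Gp p.2.

Let Theta_lin : linear_op Theta.
Proof. by case: Theta_sa. Qed.

(** By [Gperp_Gop_trace] the term with factor [l] is [- Pi (tau eta)]. Moved to the left, it turns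
    the condition into the boundary condition of the extension for the regular part [psi + eta]. *)
Lemma NsetP p : Ns p <-> [/\ E p.1, dom Theta p.2, orthoc RanTauP p.2 &
  Pi (tau (p.1 + (Gp p.2 - G0 p.2))) = Theta p.2].
Proof.
have key : E p.1 -> orthoc RanTauP p.2 -> Pi p.2 = p.2 ->
    Pi (tau p.1) = Theta p.2 + Cx l *: Pi (op_adj G0 (Gp (Pi p.2))) <->
    Pi (tau (p.1 + (Gp p.2 - G0 p.2))) = Theta p.2.
  move=> [d1 _] o2 ->; have := Gperp_Gop_trace o2; have [] := Gperp_Gop o2.
  move: (Gp p.2 - G0 p.2) => eta deta _ etr.
  rewrite -linearZ etr linearN (linear_opD tau_lin) ?tau_dom// linearD.
  by split=> [->|<-]; rewrite ?subrK ?addrK.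
have PiP x : range Pi x -> Pi x = x by move=> [y _ <-]; rewrite Pi_proj.1.
split=> [[E1 R2 [D2 o2]]|[E1 D2 o2]].
  by move/(key E1 o2 (PiP _ R2)).
have R2 : range Pi p.2 by case: Theta_sa => _ + _ _ _; apply.
by move/(key E1 o2 (PiP _ R2)).
Qed.

Let f0 : f 0 = 0.
Proof.
by rewrite /f add0r; exact: (op_adj0 Gperp_total Gperp_adj).
Qed.

Let f_linear a p q : f (a *: p + q) = a *: f p + f q.
Proof. by rewrite /f Gperp_linear scalerDr addrACA. Qed.

Lemma linear_subset_Nset : linear_subset Ns.
Proof.
case: (Theta_lin) => T0 TD TE.
have [o0 oD] := linear_subset_orthoc RanTauP.
case: (Al) => dA0 dAD AD.
split.
  apply/NsetP; split=> //.
    by split=> //; rewrite linear_op0// scaler0.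
  rewrite -[X in tau X]/(0 + (Gp 0 - G0 0)) addrA -[0 + Gp 0]/(f 0) f0 Gop0.
  by rewrite subrr linear_op0// linear0 linear_op0.
move=> a p q /NsetP[Ep Dp op ep] /NsetP[Eq Dq oq eq]; apply/NsetP; split.
- case: Ep Eq => dp e1 [dq e2]; split; first exact: dAD.
  by rewrite /= AD// e1 e2 scalerDr !scalerA mulrC.
- exact: TD.
- exact: oD.
have [dp _] := Gperp_Gop op; have [dq _] := Gperp_Gop oq.
have dp' := linear_domD Al Ep.1 dp; have dq' := linear_domD Al Eq.1 dq.
rewrite TE// -ep -eq -linearP -(linear_opZ tau_lin) ?tau_dom//.
rewrite -(linear_opD tau_lin) ?tau_dom//; last exact: linear_domZ.
(* The regular part is [f p - G0 p.2], a linear expression in [p]. *)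
rewrite !addrA -!/(f _) f_linear Gop_linear opprD scalerBr addrACA.
by rewrite /f !addrA.
Qed.

(** [Gp xi] is orthogonal to the eigenspace containing [psi], so [psi = - Gp xi] is orthogonal to
    itself; then [Gperp_eq0] removes [xi]. *)
Lemma Nset_decomposition_inj p : Ns p -> f p = 0 -> p = 0.
Proof.
case: p => psi xi /NsetP[E1 D2 o2 _] /eqP; rewrite /f addr_eq0 => /eqP e.
have psi0 : psi = 0.
  move: e o2 E1; rewrite [(psi, xi).1]/= [(psi, xi).2]/= => e o2 E1.
  by apply: inner_eq0; rewrite {2}e innerNr (Gperp_orthoc xi E1) oppr0.
have Gp0 : Gp xi = 0 by move: e => /= /esym/eqP; rewrite psi0 oppr_eq0 => /eqP.
have xi0 : xi = 0 := Gperp_eq0 o2 Gp0.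
by rewrite psi0 xi0.
Qed.

Lemma extension_eigenspace_decomposition :
  eigenspace_op L (Cx l) = f @` Ns.
Proof.
apply/seteqP; split=> [phi /(extension_eigenspaceP _ _ Theta_lin)
    |_ [[psi xi] /NsetP[E1 D2 o2 ep] <-]].
  move=> [phi0 [xi [dphi0 Dxi e ephi Aphi0]]].
  have oxi : orthoc RanTauP xi.
    by apply: (eigenvector_charge_orthogonal dphi0); rewrite -ephi.
  have [deta Aeta] := Gperp_Gop oxi.
  exists (phi0 - (Gp xi - G0 xi), xi); last first.
    by rewrite /f [LHS]/= opprB addrA subrK -ephi.
  apply/NsetP; split=> //; last by rewrite subrK.
  split; first exact: linear_domB.
  rewrite (linear_opB Al)// Aphi0 Aeta -scalerBr ephi; congr (_ *: _).
  by rewrite opprB addrA.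
have [deta Aeta] := Gperp_Gop o2.
apply/(extension_eigenspaceP _ _ Theta_lin).
exists (psi + (Gp xi - G0 xi)), xi; split=> //.
- exact: (linear_domD Al E1.1).
- by rewrite -addrA subrK.
- by rewrite (linear_opD Al)//; [rewrite E1.2 Aeta -scalerDr|exact: E1.1].
Qed.

Lemma extension_eigenspace_isolated :
  [/\ point_spectrum L (Cx l) <-> Ns <> [set 0],
      same_dim (eigenspace_op L (Cx l)) Ns &
      eigenspace_op L (Cx l) =
        [set phi | exists psi xi, Ns (psi, xi) /\ phi = psi + Gp xi]].
Proof.
have dec := extension_eigenspace_decomposition; split.
- split=> [[x + x0] N0|N0].
    rewrite dec N0 => -[p p0 fp].
    by move: x0; rewrite -fp (p0 : p = 0) f0 eqxx.
  have [p [Np p0]] : exists p, Ns p /\ p <> 0.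
    apply: contrapT => nN; apply: N0; apply/seteqP; split=> [p Np|_ ->].
      by apply: contrapT => p0; apply: nN; exists p.
    by case: linear_subset_Nset.
  exists (f p); first by rewrite dec; exists p.
  by apply/eqP => /(Nset_decomposition_inj Np).
- rewrite dec; apply: same_dim_image; first exact: linear_subset_Nset.
    by move=> a p q _ _; exact: f_linear.
  exact: Nset_decomposition_inj.
- rewrite dec; apply/seteqP; split=> [_ [[psi xi] Np <-]|_ [psi [xi [Np ->]]]].
    by exists psi, xi.
  by exists (psi, xi).
Qed.

End Isolated.

(** The charge [xi] of an eigenvector lies in the range of [Pi] and in the orthogonal complement of
    [RanTauP], hence vanishes; what remains is an eigenvector of [A] with [Pi (tau phi) = 0]. *)
Lemma extension_eigenspace_unreduced : linear_op Theta ->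
  dom Theta `<=` range Pi -> range Pi `&` orthoc RanTauP = [set 0] ->
  eigenspace_op L (Cx l) = Kset A tau Pi (Cx l).
Proof.
move=> Thl DR R0.
have T0 := linear_op0 Thl.
apply/seteqP; split=> [phi /(extension_eigenspaceP _ _ Thl)|phi [[dphi Aphi] Pphi]].
  move=> [phi0 [xi [dphi0 Dxi e ephi Aphi0]]].
  have xi0 : xi = 0.
    suff : (range Pi `&` orthoc RanTauP) xi by rewrite R0.
    split; first exact: DR.
    by apply: (eigenvector_charge_orthogonal dphi0); rewrite -ephi.
  move: e ephi; rewrite xi0 T0 Gop0 addr0 => e ephi.
  by move: Aphi0; rewrite ephi => Aphi0.
apply/(extension_eigenspaceP _ _ Thl); exists phi, 0; split=> //.
- by case: Thl.
- by rewrite T0.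
- by rewrite Gop0 addr0.
Qed.
End Extension.

Theorem theorem2p2 (R : realType) (H h : hilbertType R)
    (A : operator H H) (tau : operator H h)
    (Pi : {linear h -> h}) (Theta : operator h h)
    (lam : R[i]) (P : {linear H -> H})
    (A_selfadjoint : selfadjoint A)
    (A_resolvent0 : resolvent_set A 0)
    (tau_dom : dom tau = dom A)
    (tau_linear : linear_op tau)
    (tau_continuous : graph_continuous A tau)
    (tau_surjective : ran tau = setT)
    (tau_ker_dense : dense (op_ker tau))
    (Pi_projection : orthogonal_projection Pi)
    (Theta_selfadjoint : selfadjoint_in (range Pi) Theta)
    (lam_eigenvalue : point_spectrum A lam)
    (P_projection : orthogonal_projection P)
    (P_range : range P = eigenspace_op A lam) :
  let L := extension A tau Pi Theta in
  let RanTauP := ran (op_comp tau (total_op P)) in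
  let Kl := Kset A tau Pi lam in
  let Nl := Nset A tau Pi Theta lam P in
  (range Pi `&` orthoc RanTauP = [set 0] ->
     (point_spectrum L lam <-> Kl <> [set 0]) /\
     eigenspace_op L lam = Kl) /\
  (range Pi `&` orthoc RanTauP <> [set 0] ->
   isolated (spectrum A) lam ->
     [/\ point_spectrum L lam <-> Nl <> [set 0],
         same_dim (eigenspace_op L lam) Nl &
         eigenspace_op L lam =
           [set phi | exists psi xi,
              Nl (psi, xi) /\ phi = psi + Gperp A tau lam P xi]]).
Proof.
move=> L RanTauP Kl Nl.
have [l lE] := eigenvalue_real A_selfadjoint lam_eigenvalue.
subst lam.
case: (Theta_selfadjoint) => Thl DR _ _ _.
split=> [R0|_ /(isolated_gap A_selfadjoint)[d d0 gap]]; last first.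
  exact: (extension_eigenspace_isolated _ _ _ _ _ _ _ _ _ d0).
have EK : eigenspace_op L (real_complex R l) = Kl.
  by apply: (@extension_eigenspace_unreduced _ _ _ _ _ _ _ _ _ _ _ _ _ _ _ P).
split=> //; split=> [[x + x0] K0|K0].
  by rewrite EK K0 => x1; move: x0; rewrite (x1 : x = 0) eqxx.
apply: contrapT => nK; apply: K0; apply/seteqP; split=> [x Kx|_ ->].
  by apply: contrapT => x0; apply: nK; exists x; [rewrite EK|apply/eqP].
(* [Kl] differs from the singleton of 0 as a set, so the empty set has to be excluded by showing
   that 0 belongs to [Kl]. *)
have Al := selfadjoint_linear A_selfadjoint.
split; last by rewrite linear_op0// linear0.
by split; [case: Al|rewrite linear_op0// scaler0].
Qed.
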